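(* Let $\mathbb{S}=\mathbb{R}/2\pi\mathbb{Z}$ and for a positive integer $q$ and $t\in\mathbb{S}$ let $$U_q(t)=\bigl(\cos t,\ \sin t,\ \cos 3t,\ \sin 3t,\ \ldots,\ \cos(2q-1)t,\ \sin(2q-1)t\bigr)\in\mathbb{R}^{2q}.$$ Fix an integer $k\ge 1$. For a non-negative integer $m$ define $\Psi_{k,m}:\mathbb{S}\to\mathbb{R}^{6k(m+1)}$ by $$\Psi_{k,m}(t)=\bigl(U_{3k}(t),\ U_{3k}(5t),\ \ldots,\ U_{3k}(5^m t)\bigr).$$ For a positive even integer $n$, let $$A_{m,n}=\left\{\frac{2\pi j}{n5^m}:\ j=0,\ldots,n5^m-1\right\}\subset\mathbb{S}$$ and let $P=P_{k,m,n}=\operatorname{conv}\bigl(\Psi_{k,m}(t):\ t\in A_{m,n}\bigr)$. Then: (1) $P\subset\mathbb{R}^{6k(m+1)}$ is a centrally symmetric polytope (i.e. $P=-P$) with $n5^m$ distinct vertices, namely $\Psi_{k,m}(t)$ for $t\in A_{m,n}$, and its dimension satisfies $\dim P\le 6k(m+1)-2m\lfloor(3k+2)/5\rfloor$; moreover, if $n>2(6k-1)$, then $\dim P=6k(m+1)-2m\lfloor(3k+2)/5\rfloor$. (2) Let $t_1,\ldots,t_k$ be points chosen independently at random from the uniform distribution on $A_{m,n}$ (some of them may coincide). Then the probability that $\operatorname{conv}\bigl(\Psi_{k,m}(t_1),\ldots,\Psi_{k,m}(t_k)\bigr)$ is not a face of $P$ is at most $\left(1-5^{-k+1}\right)^m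$.
   Context: A polytope is the convex hull of finitely many points in $\mathbb{R}^d$. A face of a convex body is its intersection with a supporting affine hyperplane. The dimension of a polytope is the dimension of its affine hull. *)

(* Defs.v *)
From HB Require Import structures.
From mathcomp Require Import all_boot all_order all_algebra.
From mathcomp Require Import all_classical all_reals.
From mathcomp Require Import trigo.



Unset Printing Implicit Defensive.

Import Order.TTheory GRing.Theory Num.Theory.
Local Open Scope ring_scope.
Local Open Scope classical_set_scope.

Section Defs.
Variable R : realType.

Definition dotv (N : nat) (x y : 'rV[R]_N) : R := \sum_(i < N) x 0 i * y 0 i.

Definition conv (N M : nat) (p : 'I_M -> 'rV[R]_N) : set 'rV[R]_N :=
  [set x | exists l : 'I_M -> R,
     (forall j, 0 <= l j) /\ \sum_(j < M) l j = 1 /\ x = \sum_(j < M) l j *: p j].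

Definition is_face (N : nat) (K F : set 'rV[R]_N) : Prop :=
  exists (c : 'rV[R]_N) (b : R),
    c != 0 /\ (forall x, K x -> dotv N c x <= b) /\
    (exists x, K x /\ dotv N c x = b) /\
    F = [set x | K x /\ dotv N c x = b].

Definition is_vertex (N : nat) (K : set 'rV[R]_N) (v : 'rV[R]_N) : Prop :=
  is_face N K [set v].

(* dimension of the affine hull of K: the least rank of a linear subspace V
   (row space of a square matrix) such that K lies in a translate of V,
   i.e. all differences x - y (x, y in K) lie in V. *)
Definition affdim (N : nat) (K : set 'rV[R]_N) : nat :=
  \big[minn/N]_(d < N.+1 | `[< exists V : 'M[R]_N,
        \rank V = d /\ (forall x y, K x -> K y -> (x - y <= V)%MS) >]) (d : nat).

Definition Psi (k m : nat) (t : R) : 'rV[R]_(6 * k * (m.+1)) :=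
  \row_(i < 6 * k * (m.+1))
    let b := (i %/ (6 * k))%N in
    let r := (i %% (6 * k))%N in
    let f := (((r %/ 2).*2.+1) * 5 ^ b)%N in
    if odd r then sin (f%:R * t) else cos (f%:R * t).

Definition tA (m n j : nat) : R := 2 * pi * j%:R / (n * 5 ^ m)%:R.

Definition Pkmn (k m n : nat) : set 'rV[R]_(6 * k * (m.+1)) :=
  conv _ _ (fun j : 'I_(n * 5 ^ m) => Psi k m (tA m n j)).

End Defs.

Arguments dotv {R N}.
Arguments conv {R N M}.
Arguments is_face {R N}.
Arguments is_vertex {R N}.
Arguments affdim {R N}.
Arguments Psi {R}.
Arguments tA {R}.
Arguments Pkmn {R}.

(* Main.v *)
Require Import Defs.
From HB Require Import structures.
From mathcomp Require Import all_boot all_order all_algebra.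
From mathcomp Require Import all_classical all_reals.
From mathcomp Require Import trigo.
From mathcomp Require Import topology normedtype derive.
From mathcomp Require Import ring lra zify.

Import Order.TTheory GRing.Theory Num.Theory.
Import numFieldNormedType.Exports.
Local Open Scope ring_scope.
Local Open Scope classical_set_scope.
Set Implicit Arguments.
Unset Strict Implicit.

(** Proof idea. A linear functional on the image of Psi, restricted to the block b,
    is f (5 ^ b * t) with f a trigonometric polynomial with odd frequencies < 6k; such
    f are exactly the forms of degree 6k - 1 in (cos t, sin t), and a form of degree d
    with d zeros distinct mod pi is a multiple of prod sin (t - z).

    Local neighborliness: given t_0 < ... < t_r in an arc shorter than pi / 2, let g
    be the form of degree 2r + 1 with g = 1 and g' = 0 at every t_i. By Rolle all the
    zeros of g' lie in the arc, so g' = C prod sin (t - z), whose sign pattern gives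
    g < 1 in the gaps. Beyond b = t_r, g decreases from 1 to -1 = g (t_0 + pi), and
    reflection at b increases every |sin (t - z)|, hence |g'|; so g (t) + g (2b - t)
    is nondecreasing on the arc, which forces g > -1 there. By antiperiodicity g < 1
    away from the t_i, and g exposes their convex hull.

    Probability: if for some c < m the points 5 ^ c * t_i lie in an arc of length
    2 pi / 5, then g (5 ^ c * t) exposes those t with 5 ^ c * t among the 5 ^ c * t_i.
    One descends to c = 0: at level c - 1 there are at most 5k candidates, pairwise
    distinct mod pi, and a form of degree 6k - 1 takes any prescribed values there,
    in particular 1 at the 5 ^ (c - 1) * t_i and 0 at the others. Given the points
    at level c + 1, at least 5 of the 5 ^ k lifts to level c lie in such an arc.

    Dimension: the upper bound comes from the frequencies repeated between blocks;
    the lower one from the orthogonality of the remaining trigonometric functions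
    on the n * 5 ^ m equally spaced points. *)

(** * Forms in cosine and sine *)

Section TrigForms.
Variable R : realType.
Implicit Types (f g h : R -> R) (a b c x y z : R) (d : nat) (s : seq R).

(* Restrictions to the unit circle of homogeneous polynomials of degree d in (cos, sin). *)
Fixpoint tform d f : Prop :=
  match d with
  | 0%N => exists c, forall x, f x = c
  | d'.+1 => exists f1 f2, [/\ tform d' f1, tform d' f2 &
      forall x, f x = cos x * f1 x + sin x * f2 x]
  end.

Lemma eq_tform d f g : f =1 g -> tform d f -> tform d g.
Proof.
by case: d => [|d] fg /=; [move=> [c fc]; exists c => x|
  move=> [f1] [f2] [F1 F2 fE]; exists f1, f2; split=> // x]; rewrite -fg.
Qed.

Lemma tform_lin d c f g : tform d f -> tform d g -> tform d (fun x => c * f x + g x).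
Proof.
elim: d f g => [|d IH] f g /=.
  by move=> [a fa] [b gb]; exists (c * a + b) => x; rewrite fa gb.
move=> [f1] [f2] [F1 F2 fE] [g1] [g2] [G1 G2 gE].
exists (fun x => c * f1 x + g1 x), (fun x => c * f2 x + g2 x).
by split; [exact: IH|exact: IH|move=> x; rewrite fE gE; ring].
Qed.

Lemma tform0 d : tform d (fun=> 0).
Proof.
elim: d => [|d IH] /=; first by exists 0.
by exists (fun=> 0), (fun=> 0); split=> // x; ring.
Qed.

Lemma tformZ d c f : tform d f -> tform d (fun x => c * f x).
Proof.
by move=> F; apply: eq_tform (tform_lin c F (tform0 d)) => x; rewrite addr0.
Qed.

Lemma tformD d f g : tform d f -> tform d g -> tform d (fun x => f x + g x).
Proof. by move=> F G; apply: eq_tform (tform_lin 1 F G) => x; rewrite mul1r. Qed.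

Lemma tform_cosM d a f : tform d f -> tform d.+1 (fun x => cos (x - a) * f x).
Proof.
move=> F; exists (fun x => cos a * f x), (fun x => sin a * f x).
by split; [exact: tformZ|exact: tformZ|move=> x; rewrite cosB; ring].
Qed.

Lemma tform_sinM d a f : tform d f -> tform d.+1 (fun x => sin (x - a) * f x).
Proof.
move=> F; exists (fun x => - sin a * f x), (fun x => cos a * f x).
by split; [exact: tformZ|exact: tformZ|move=> x; rewrite sinB; ring].
Qed.

(** A rotation acts linearly on (cos, sin), so each factor of the recursion turns into a combination
    of [cos x] and [sin x]. *)
Lemma tform_shift d a f : tform d f -> tform d (fun x => f (x - a)).
Proof.
elim: d f => [|d IH] f /=; first by move=> [c fc]; exists c.
move=> [f1] [f2] [/IH F1 /IH F2 fE].
apply: eq_tform (tformD (tform_cosM a F1) (tform_sinM a F2)) => x.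
by rewrite fE.
Qed.

Lemma tform_prod_sin s : tform (size s) (fun x => \prod_(z <- s) sin (x - z)).
Proof.
elim: s => [|z s IH] /=; first by exists 1 => x; rewrite big_nil.
by apply: eq_tform (tform_sinM z IH) => x; rewrite big_cons.
Qed.

Lemma tform_cos a : tform 1 (fun x => cos (x - a)).
Proof.
have F : tform 0 (fun=> 1 : R) by exists 1.
by apply: eq_tform (tform_cosM a F) => x; rewrite mulr1.
Qed.

Lemma tform_sin a : tform 1 (fun x => sin (x - a)).
Proof.
have F : tform 0 (fun=> 1 : R) by exists 1.
by apply: eq_tform (tform_sinM a F) => x; rewrite mulr1.
Qed.

Lemma tformDpi d f x : tform d f -> f (x + pi) = (-1) ^+ d * f x.
Proof.
elim: d f => [|d IH] f /=; first by move=> [c fc]; rewrite !fc mul1r.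
move=> [f1] [f2] [/IH F1 /IH F2 fE].
by rewrite !fE F1 F2 cosDpi sinDpi exprS; ring.
Qed.

Lemma tform_odd_Dpi d f x : tform d f -> odd d -> f (x + pi) = - f x.
Proof. by move=> F od; rewrite (tformDpi x F) -signr_odd od mulN1r. Qed.

Lemma tform_derive d f : tform d f ->
  exists2 f', tform d f' & forall x, is_derive x 1 f (f' x).
Proof.
elim: d f => [|d IH] f /=.
  move=> [c fc]; exists (fun=> 0); first by exists 0.
  move=> x; have -> : f = cst c by apply/funext.
  exact: is_derive_cst.
move=> [f1] [f2] [F1 F2 fE].
have [f1' F1' D1] := IH _ F1; have [f2' F2' D2] := IH _ F2.
exists (fun x => cos x * (f1' x + f2 x) + sin x * (f2' x + - 1 * f1 x)).
  exists (fun x => f1' x + f2 x), (fun x => f2' x + - 1 * f1 x).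
  by split=> //; apply: tformD => //; apply: tformZ.
move=> x; have -> : f = cos * f1 + sin * f2 by apply/funext => y; rewrite fE.
by apply: is_derive_eq; rewrite /GRing.scale /=; ring.
Qed.

(** In the rotated coordinates [cos (x - a)] and [sin (x - a)], the coefficient of [cos (x - a)] is
    [cos a * f1 x + sin a * f2 x]. At [a] it equals [f a = 0], so by induction it is itself a
    multiple of [sin (x - a)]. *)
Lemma tform_root d a f : tform d.+1 f -> f a = 0 ->
  exists2 h, tform d h & forall x, f x = sin (x - a) * h x.
Proof.
elim: d f => [|d IH] f [f1] [f2] [F1 F2 fE] fa0.
  have [c1 f1E] := F1; have [c2 f2E] := F2.
  have cs := cos2Dsin2 a.
  exists (fun=> cos a * c2 - sin a * c1); first by exists (cos a * c2 - sin a * c1).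
  move=> x; rewrite fE sinB; move: fa0; rewrite fE !f1E !f2E => fa0.
  have -> : cos x * c1 + sin x * c2 =
     (cos a ^+ 2 + sin a ^+ 2) * (cos x * c1 + sin x * c2) by rewrite cs mul1r.
  have -> : (cos a ^+ 2 + sin a ^+ 2) * (cos x * c1 + sin x * c2) =
    (cos x * cos a + sin x * sin a) * (cos a * c1 + sin a * c2) +
    (sin x * cos a - cos x * sin a) * (cos a * c2 - sin a * c1) by ring.
  by rewrite fa0 mulr0 add0r.
have G2 : tform d.+1 (fun x => cos a * f1 x + sin a * f2 x).
  by apply: tformD; apply: tformZ.
have [h2 H2 h2E] : exists2 h, tform d h &
    forall x, cos a * f1 x + sin a * f2 x = sin (x - a) * h x.
  by apply: IH => //=; rewrite -fE.
exists (fun x => (cos a * f2 x + - sin a * f1 x) + cos (x - a) * h2 x).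
  by apply: tformD; [apply: tformD; apply: tformZ|apply: tform_cosM].
move=> x; rewrite mulrDr.
have -> : sin (x - a) * (cos (x - a) * h2 x) =
  cos (x - a) * (cos a * f1 x + sin a * f2 x) by rewrite h2E; ring.
have cs := cos2Dsin2 a.
transitivity ((cos a ^+ 2 + sin a ^+ 2) * f x); first by rewrite cs mul1r.
by rewrite fE sinB cosB; ring.
Qed.

(** Roots are split off one at a time. Those left stay roots of the quotient because they differ
    from the removed one mod pi, and after [d] steps the quotient is a constant. *)
Lemma tform_factor d f s : tform d f -> size s = d ->
    {in s, forall z, f z = 0} -> pairwise (fun y z => sin (z - y) != 0) s ->
  exists c, forall x, f x = c * \prod_(z <- s) sin (x - z).
Proof.
elim: s d f => [|a s IH] [|d] f //.
  by move=> [c fc] _ _ _; exists c => x; rewrite big_nil mulr1.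
move=> F [sd] fs; rewrite pairwise_cons => /andP[/allP a_s s_s].
have [h H hE] := tform_root F (fs a (mem_head _ _)).
have [|c hc] := IH _ _ H sd _ s_s.
  move=> z zs; have /eqP := fs z (mem_behead (s := a :: s) zs).
  by rewrite hE mulf_eq0 (negPf (a_s z zs)) /= => /eqP.
by exists c => x; rewrite hE hc big_cons; ring.
Qed.

(** Newton interpolation: the value at a new node is corrected by a multiple of a form that vanishes
    at the earlier nodes. *)
Lemma tform_interpolation d s (v : R -> R) : (size s <= d.+1)%N -> uniq s ->
    {in s &, forall y z, y != z -> sin (z - y) != 0} ->
  exists2 h, tform d h & {in s, forall z, h z = v z}.
Proof.
elim: s => [|a s IH] /=; first by exists (fun=> 0) => //; exact: tform0.
rewrite ltnS => sd /andP[a_s us] sin_s.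
have [|h H hv] := IH (leqW sd) us.
  by move=> y z ys zs; apply: sin_s; rewrite inE ?ys ?zs orbT.
(* The power of [cos (x - a)] only pads the degree up to [d]; it equals 1 at [a]. *)
pose N x := cos (x - a) ^+ (d - size s) * \prod_(z <- s) sin (x - z).
have FN : tform d N.
  rewrite /N -[X in tform X](subnK sd); elim: (d - size s)%N => [|e IHe].
    by apply: eq_tform (tform_prod_sin s) => x; rewrite expr0 mul1r.
  by apply: eq_tform (tform_cosM a IHe) => x; rewrite exprS mulrA.
have Na : N a != 0.
  rewrite /N subrr cos0 expr1n mul1r prodf_seq_neq0; apply/allP => z zs /=.
  by apply: sin_s; rewrite ?inE ?eqxx ?zs ?orbT //; apply: contraNneq a_s => <-.
exists (fun x => (v a - h a) / N a * N x + h x); first exact: tform_lin.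
move=> z; rewrite inE => /orP[/eqP -> | zs]; first by rewrite divfK// subrK.
have -> : N z = 0 by rewrite /N (big_rem z zs) /= subrr sin0 mul0r mulr0.
by rewrite mulr0 add0r hv.
Qed.
End TrigForms.

(** * Prescribing the value 1 and the derivative 0 *)

Section HermiteInterpolation.
Variable R : realType.
Implicit Types (f g h : R -> R) (a b c x y z : R) (d : nat) (s : seq R).

Lemma tform_raise d f : tform d f -> tform d.+2 f.
Proof.
move=> F; exists (fun x => cos (x - 0) * f x), (fun x => sin (x - 0) * f x).
split; [exact: tform_cosM|exact: tform_sinM|move=> x].
by rewrite subr0 !mulrA -mulrDl -!expr2 cos2Dsin2 mul1r.
Qed.

(** For a new node [b], a correction [N ^ 2 * L] is added, where [N] vanishes at the old nodes. The
    square preserves values and derivatives there, and the linear form [L] has two coefficients, one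
    for the value at [b] and one for the derivative. *)
Lemma tform_hermite a s : uniq (a :: s) ->
    {in a :: s &, forall y z, y != z -> sin (z - y) != 0} ->
  exists2 h, tform (size s).*2.+1 h &
    {in a :: s, forall z, h z = 1 /\ is_derive z 1 h 0}.
Proof.
elim: s => [|b s IH] U S.
  exists (fun x => cos (x - a)); first exact: tform_cos.
  move=> z; rewrite inE => /eqP ->; rewrite subrr cos0; split=> //.
  have -> : (fun x => cos (x - a)) = cos \o (id - cst a) by [].
  apply: is_derive_eq; rewrite !fctE.
  by rewrite subrr sin0 oppr0 mul0r.
have sub : {subset a :: s <= [:: a, b & s]}.
  by move=> z; rewrite !inE => /orP[->|->]; rewrite ?orbT.
have [|y z ys zs|h H hv] := IH.
- by move: U; rewrite /= inE negb_or => /and3P[/andP[_ ->] _ ->].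
- by apply: S; apply: sub.
pose N x := \prod_(z <- a :: s) sin (x - z).
have FN : tform (size (a :: s)) N by apply: tform_prod_sin.
have Nb : N b != 0.
  rewrite prodf_seq_neq0; apply/allP => z zs /=; apply: S; first exact: sub.
    by rewrite !inE eqxx orbT.
  apply: contraTneq zs => ->; move: U; rewrite /= !inE !negb_or.
  by move=> /and3P[/andP[ab _] -> _]; rewrite eq_sym ab.
have Nz z : z \in a :: s -> N z = 0.
  by move=> zs; rewrite /N (big_rem z zs) /= subrr sin0 mul0r.
have [N' _ DN] := tform_derive FN; have [h' _ Dh] := tform_derive H.
(* [be] and [al] solve the two equations [h1 b = 1] and [h1' b = 0]. *)
pose be := (1 - h b) / N b ^+ 2.
pose al := - (h' b + 2 * N b * N' b * be) / N b ^+ 2.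
pose L x := be * cos (x - b) + al * sin (x - b).
pose h1 x := N x ^+ 2 * L x + h x.
pose h1' x := N x ^+ 2 * (- be * sin (x - b) + al * cos (x - b))
  + 2 * N x * N' x * L x + h' x.
have Dh1 x : is_derive x 1 h1 (h1' x).
  have -> : h1 = (N * N) * (be *: (cos \o (id - cst b)) + al *: (sin \o (id - cst b))) + h.
    by apply/funext => y; rewrite /h1 /L expr2.
  by apply: is_derive_eq; rewrite /h1' /L !fctE /GRing.scale /=; ring.
exists h1.
  apply: tformD; last by rewrite doubleS; apply: tform_raise.
  have FL : tform 1 L.
    by apply: tformD; apply: tformZ; [exact: tform_cos|exact: tform_sin].
  have FP s' d f : tform d f -> tform (size s' + d) (fun x => (\prod_(z <- s') sin (x - z)) * f x).
    move=> F; elim: s' => [|z s' IHs]; first by apply: eq_tform F => x; rewrite big_nil mul1r.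
    by apply: eq_tform (tform_sinM z IHs) => x; rewrite big_cons mulrA.
  have -> : (size (b :: s)).*2.+1 = (size (a :: s) + (size (a :: s) + 1))%N.
    by rewrite addnA addn1 addnn.
  by apply: eq_tform (FP _ _ _ (FP _ _ _ FL)) => x; rewrite /N; ring.
move=> z; have [zs _|zs zs'] := boolP (z \in a :: s).
  have [hz1 Dz] := hv z zs; rewrite /h1 Nz// expr0n mul0r add0r hz1; split=> //.
  apply: is_derive_eq; rewrite /h1' Nz//.
  have <- : 'D_1 h z = h' z by exact: derive_val.
  by rewrite derive_val expr0n /=; ring.
have -> : z = b.
  by move: zs zs'; rewrite !inE negb_or => /andP[/negPf -> /negPf ->]; rewrite orbF => /eqP.
rewrite /h1 /L subrr cos0 sin0 /be; split; first by field.
apply: is_derive_eq; rewrite /h1' /L subrr cos0 sin0 /al /be; by field.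
Qed.

End HermiteInterpolation.

(** * Local neighborliness *)

Section LocalNeighborliness.
Variable R : realType.
Implicit Types (f g h : R -> R) (a b c x y z : R) (d : nat).

Lemma MVT_derive f f' a b : a < b -> (forall x, is_derive x 1 f (f' x)) ->
  exists2 c, a < c < b & f b - f a = f' c * (b - a).
Proof.
move=> ab Df.
have cf : {within `[a, b], continuous f}.
  apply: continuous_subspaceT => x; apply: differentiable_continuous.
  by apply/derivable1_diffP; case: (Df x).
by have [c] := MVT ab (fun x _ => Df x) cf; rewrite in_itv /=; exists c.
Qed.

Lemma derive_neg_decreasing f f' a b : a < b ->
    (forall x, is_derive x 1 f (f' x)) ->
  (forall x, a < x < b -> f' x < 0) -> f b < f a.
Proof.
move=> ab Df neg; have [c cab fE] := MVT_derive ab Df.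
by rewrite -subr_lt0 fE pmulr_llt0 ?subr_gt0// neg.
Qed.

Lemma derive_pos_increasing f f' a b : a < b ->
    (forall x, is_derive x 1 f (f' x)) ->
  (forall x, a < x < b -> 0 < f' x) -> f a < f b.
Proof.
move=> ab Df pos; have [c cab fE] := MVT_derive ab Df.
by rewrite -subr_gt0 fE pmulr_lgt0 ?subr_gt0// pos.
Qed.

(* sin^2 A - sin^2 B = sin (A - B) * sin (A + B) with A = 2b - x - z and B = x - z. *)
Lemma ler_norm_sin_reflect b x z : 0 <= x <= b -> 0 <= z <= b -> b < pi / 2 ->
  `|sin (x - z)| <= sin (2 * b - x - z).
Proof.
move=> /andP[x0 xb] /andP[z0 zb] bpi.
have A0 : 0 <= sin (2 * b - x - z) by apply: sin_ge0_pi; lra.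
rewrite -[leRHS]ger0_norm// -ler_sqr ?nnegrE// !real_normK ?num_real//.
rewrite -subr_ge0.
have -> : sin (2 * b - x - z) ^+ 2 - sin (x - z) ^+ 2 =
   sin (2 * b - 2 * x) * sin (2 * b - 2 * z).
  have -> : 2 * b - 2 * x = (2 * b - x - z) - (x - z) by ring.
  have -> : 2 * b - 2 * z = (2 * b - x - z) + (x - z) by ring.
  set A := 2 * b - x - z; set B := x - z; rewrite [sin (A - B)]sinB [sin (A + B)]sinD.
  transitivity (sin A ^+ 2 * cos B ^+ 2 - cos A ^+ 2 * sin B ^+ 2); last by ring.
  by rewrite !cos2sin2; ring.
by apply: mulr_ge0; apply: sin_ge0_pi; lra.
Qed.

(** * Points of an arc shorter than a quarter turn, rotated so that the first is 0 *)

Section Points.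
Variables (r : nat) (t : nat -> R).
Hypothesis t_mono : forall i j, (i < j <= r)%N -> t i < t j.
Hypothesis t0 : t 0%N = 0.
Hypothesis tr : t r < pi / 2.

Lemma points_le i j : (i <= j <= r)%N -> t i <= t j.
Proof.
case/andP; rewrite leq_eqVlt => /orP[/eqP -> //|ij] jr.
by apply/ltW/t_mono; rewrite ij.
Qed.

Lemma points_itv i : (i <= r)%N -> 0 <= t i <= t r.
Proof. by move=> ir; rewrite -t0 !points_le ?leqnn ?ir ?leq0n. Qed.

Lemma points_inj i j : (i <= r)%N -> (j <= r)%N -> t i = t j -> i = j.
Proof.
move=> ir jr tij; case: (ltngtP i j) => // lt.
  by have := @t_mono i j; rewrite lt jr tij ltxx => /(_ isT).
by have := @t_mono j i; rewrite lt ir tij ltxx => /(_ isT).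
Qed.

Lemma sin_sub_neq0 y z : 0 <= y <= t r -> 0 <= z <= t r -> y != z ->
  sin (z - y) != 0.
Proof.
move=> /andP[y0 yr] /andP[z0 zr]; have := tr; have := pi_gt0 R.
case: (ltgtP y z) => // yz pi0 tr' _.
  by rewrite gt_eqF// sin_gt0_pi//; lra.
by rewrite -[z - y]opprB sinN oppr_eq0 gt_eqF// sin_gt0_pi//; lra.
Qed.

Lemma hermite_points : exists2 g, tform r.*2.+1 g &
  forall i, (i <= r)%N -> g (t i) = 1 /\ is_derive (t i) 1 g 0.
Proof.
have E0 : 0 :: [seq t i | i <- iota 1 r] = [seq t i | i <- iota 0 r.+1] by rewrite /= t0.
have [] := @tform_hermite R 0 [seq t i | i <- iota 1 r].
- rewrite E0 map_inj_in_uniq ?iota_uniq// => i j.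
  by rewrite !mem_iota /= !add0n !ltnS; exact: points_inj.
- move=> y z; rewrite E0 => /mapP[i + ->] /mapP[j + ->].
  rewrite !mem_iota /= !add0n !ltnS => ir jr.
  by apply: sin_sub_neq0; exact: points_itv.
move=> g; rewrite size_map size_iota => G gv; exists g => // i ir; apply: gv.
by rewrite E0 map_f// mem_iota /= add0n ltnS.
Qed.

Lemma local_neighborliness : exists2 g, tform r.*2.+1 g &
  forall x, 0 <= x < 2 * pi -> g x <= 1 /\
    (g x = 1 <-> exists2 i, (i <= r)%N & x = t i).
Proof.
have [g G gt] := hermite_points.
have [g' G' Dg] := tform_derive G.
have gt1 i : (i <= r)%N -> g (t i) = 1 by move=> /gt[].
have g't i : (i <= r)%N -> g' (t i) = 0.
  move=> /gt[_ D0]; have <- : 'D_1 g (t i) = g' (t i) by exact: derive_val.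
  exact: derive_val.
have gpi x : g (x + pi) = - g x.
  by apply: (tform_odd_Dpi _ G); rewrite /= odd_double.
(* [u i] is a Rolle point of [g] between two consecutive nodes; for [i >= r] it is the irrelevant
   default 0. *)
have /boolp.choice[u uP] i : exists y, (i < r)%N -> t i < y < t i.+1 /\ g' y = 0.
  case: (ltnP i r) => [ir|_]; last by exists 0.
  have tii : t i < t i.+1 by apply: t_mono; rewrite ltnSn ir.
  have [c ci] := MVT_derive tii Dg; rewrite !gt1// ?(ltnW ir)// subrr => /esym/eqP.
  rewrite mulf_eq0 subr_eq0 (gt_eqF tii) orbF => /eqP gc.
  by exists c.
have u_itv i : (i < r)%N -> 0 <= u i <= t r.
  move=> ir; have [/andP[iu ui] _] := uP i ir.
  have /andP[ti0 _] := points_itv (ltnW ir); have /andP[_ tir] := points_itv ir.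
  by apply/andP; split; lra.
have u_lt i j : (i < j < r)%N -> u i < u j.
  move=> /andP[ij jr]; have [/andP[_ ui] _] := uP i (ltn_trans ij jr).
  have [/andP[uj _] _] := uP j jr.
  by have := @points_le i.+1 j; rewrite ij (ltnW jr) => /(_ isT); lra.
(* The [r + 1] nodes and the [r] Rolle points are as many zeros as the degree [2r + 1] of [g']
   allows. *)
pose zs := [seq t i | i <- iota 0 r.+1] ++ [seq u i | i <- iota 0 r].
have zsP z : z \in zs -> 0 <= z <= t r /\ g' z = 0.
  rewrite mem_cat => /orP[] /mapP[i + ->]; rewrite mem_iota add0n.
    by rewrite ltnS /= => ir; split; [exact: points_itv|exact: g't].
  by move=> /= ir; split; [exact: u_itv|have [] := uP i ir].
have uzs : uniq zs.
  rewrite cat_uniq; apply/and3P; split.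
  - rewrite map_inj_in_uniq ?iota_uniq// => i j; rewrite !mem_iota /= !add0n !ltnS.
    exact: points_inj.
  - apply/hasPn => z /mapP[i]; rewrite mem_iota /= add0n => ir ->.
    suff: ~ u i \in [seq t i | i <- iota 0 r.+1] by move/negP.
    move=> /mapP[j]; rewrite mem_iota /= add0n ltnS => jr uij.
    have [/andP[iu ui] _] := uP i ir.
    case: (leqP j i) => ij.
      by have := @points_le j i; rewrite ij (ltnW ir) => /(_ isT); lra.
    by have := @points_le i.+1 j; rewrite ij jr => /(_ isT); lra.
  - rewrite map_inj_in_uniq ?iota_uniq// => i j; rewrite !mem_iota /= !add0n.
    move=> ir jr uij; case: (ltngtP i j) => // lt.
      by have := @u_lt i j; rewrite lt jr uij ltxx => /(_ isT).
    by have := @u_lt j i; rewrite lt ir uij ltxx => /(_ isT).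
have [C g'zs] : exists C, forall x, g' x = C * \prod_(z <- zs) sin (x - z).
  apply: (tform_factor G').
  - by rewrite size_cat !size_map !size_iota addSn addnn.
  - by move=> z /zsP[].
  - rewrite uniq_pairwise in uzs; apply: (sub_in_pairwise (P := mem zs)) uzs.
      move=> y z /zsP[y_itv _] /zsP[z_itv _] /=; exact: sin_sub_neq0.
    by apply/allP.
(* The node 0 gives the factor [sin x]. Pairing [u i] with [t i.+1] makes the product of the two
   sines positive at points of the arc outside the interval they bound. *)
have g'E x : g' x = C * sin x * \prod_(i < r) (sin (x - u i) * sin (x - t i.+1)).
  rewrite g'zs big_cat !big_map /= big_cons t0 subr0 big_split /=.
  have -> : iota 0 r = index_iota 0 r by rewrite /index_iota subn0.
  rewrite big_mkord.
  have -> : iota 1 r = index_iota 1 r.+1 by rewrite /index_iota subSS subn0.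
  by rewrite big_add1 big_mkord /=; ring.
have tr0 : 0 <= t r by have /andP[] := points_itv (leqnn r).
have pi0 := pi_gt0 R; have tr' := tr.
have sin_gt0_r x z : t r < x < pi -> 0 <= z <= t r -> 0 < sin (x - z).
  by move=> xr zr; apply: sin_gt0_pi; lra.
have gpi1 : g pi = -1 by rewrite -[X in g X]add0r gpi -t0 gt1.
(* [g] drops from 1 at [t r] to -1 at pi, so [g'] is negative somewhere between, where every sine
   factor is positive. *)
have C_lt0 : C < 0.
  have [|c cr cE] := @MVT_derive g g' (t r) pi _ Dg; first by lra.
  rewrite gpi1 gt1// in cE.
  have : g' c < 0 by rewrite ltNge; apply/negP => g'c; nra.
  rewrite g'zs pmulr_llt0// big_seq prodr_gt0// => z /zsP[z_itv _].
  by apply: sin_gt0_r => //; lra.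
have g'_right x : t r < x < pi -> g' x < 0.
  move=> xr; rewrite g'zs pmulr_llt0// big_seq prodr_gt0// => z /zsP[z_itv _].
  exact: sin_gt0_r.
have g_right x : t r < x < pi -> -1 < g x < 1.
  move=> /andP[rx xpi]; apply/andP; split.
    rewrite -gpi1; apply: (derive_neg_decreasing xpi Dg) => y /andP[xy ypi].
    by apply: g'_right; lra.
  rewrite -(gt1 r)//; apply: (derive_neg_decreasing rx Dg) => y /andP[ry yx].
  by apply: g'_right; lra.
(* Comparing the products factor by factor gives [|g' x| <= - g' (2 * t r - x)]. *)
have g'_reflect x : 0 <= x <= t r -> g' (2 * t r - x) <= g' x.
  move=> x_itv; apply: le_trans (lerNnormlW (lexx `|g' x|)).
  rewrite lerNr !g'zs normrM (ltr0_norm C_lt0) -mulNr ler_wpM2l ?oppr_ge0 ?(ltW C_lt0)//.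
  rewrite normr_prod !big_seq; apply: ler_prod => z /zsP[z_itv _].
  by rewrite normr_ge0 ler_norm_sin_reflect.
have g_gtN1 x : 0 <= x <= t r -> -1 < g x.
  case/andP; rewrite le_eqVlt => /orP[/eqP <- _|x0 xr].
    by rewrite -t0 gt1//; lra.
  (* [K] is nondecreasing on the arc and [K 0 = 1 + g (2 * t r) > 0]. As the reflected term of [K x]
     is at most 1, [g x > -1] follows. *)
  pose K y := g y + g (2 * t r - y).
  have DK y : is_derive y 1 K (g' y - g' (2 * t r - y)).
    have -> : K = g + (g \o (cst (2 * t r) - id)) by [].
    by apply: is_derive_eq; rewrite !fctE /GRing.scale /=; ring.
  have [c c_itv] := MVT_derive x0 DK; rewrite /K !subr0 -{1}t0 gt1// => KE.
  have : 0 <= (g' c - g' (2 * t r - c)) * x.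
    by rewrite mulr_ge0 ?subr_ge0 ?g'_reflect ?(ltW x0)//; lra.
  have /andP[g2 _] : -1 < g (2 * t r) < 1 by apply: g_right; lra.
  have : g (2 * t r - x) <= 1.
    move: xr; rewrite le_eqVlt => /orP[/eqP ->|xr].
      by rewrite mulr_natl mulr2n addrK gt1.
    by have /andP[_ /ltW] : -1 < g (2 * t r - x) < 1 by apply: g_right; lra.
  by rewrite -KE; lra.
have sin_pos y z : 0 <= y <= t r -> 0 <= z <= t r -> z < y -> 0 < sin (y - z).
  by move=> *; apply: sin_gt0_pi; lra.
have sin_neg y z : 0 <= y <= t r -> 0 <= z <= t r -> y < z -> sin (y - z) < 0.
  by move=> *; rewrite -opprB sinN oppr_lt0; apply: sin_gt0_pi; lra.
have pair_pos j y : (j < r)%N -> 0 <= y <= t r -> (y < u j) || (t j.+1 < y) ->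
    0 < sin (y - u j) * sin (y - t j.+1).
  move=> jr y_itv; have u_j := u_itv j jr; have t_j := points_itv jr.
  have [/andP[_ uj] _] := uP j jr; case/orP => yj.
    by rewrite nmulr_rgt0 sin_neg//; apply: lt_trans uj.
  by rewrite pmulr_rgt0 sin_pos//; apply: lt_trans yj.
have pair_pos_away i j y : (i < r)%N -> (j < r)%N -> j != i -> t i < y < t i.+1 ->
    0 < sin (y - u j) * sin (y - t j.+1).
  move=> ir jr ji /andP[iy yi]; have /andP[ti0 _] := points_itv (ltnW ir).
  have /andP[_ tir] := points_itv ir.
  apply: pair_pos => //; first by lra.
  case: (ltngtP j i) ji => // ij _; apply/orP.
    right; have := @points_le j.+1 i; rewrite ij (ltnW ir) => /(_ isT); lra.
  left; have := @points_le i.+1 j; rewrite ij (ltnW jr) => /(_ isT).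
  by have [/andP[uj _] _] := uP j jr; lra.
(* Inside the gap only the pair of index [i] changes sign, at [u i]: [g] decreases from 1 before
   [u i] and increases back to 1 after it. *)
have g_gap i x : (i < r)%N -> t i < x < t i.+1 -> g x < 1.
  move=> ir /andP[ix xi]; have [/andP[iu ui] _] := uP i ir.
  have /andP[ti0 _] := points_itv (ltnW ir); have /andP[_ tir] := points_itv ir.
  case: (leP x (u i)) => xu.
    rewrite -(gt1 i)// ?(ltnW ir)//; apply: (derive_neg_decreasing ix Dg) => y y_itv.
    rewrite g'E pmulr_llt0; last first.
      apply: prodr_gt0 => j _; have [-> |ji] := eqVneq (j : nat) i.
        by apply: pair_pos => //; lra.
      by apply: (@pair_pos_away i) => //; lra.
    by rewrite pmulr_llt0// sin_gt0_pi//; lra.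
  rewrite -(gt1 i.+1)//; apply: (derive_pos_increasing xi Dg) => y y_itv.
  rewrite g'E (bigD1 (Ordinal ir))//= mulrA pmulr_lgt0; last first.
    by apply: prodr_gt0 => j ji; apply: (@pair_pos_away i) => //; lra.
  rewrite nmulr_rgt0; last by rewrite pmulr_llt0// sin_gt0_pi//; lra.
  have u_i := u_itv i ir; have t_i := points_itv ir.
  by rewrite pmulr_rlt0 ?sin_pos ?sin_neg//; lra.
have g_left x : 0 <= x <= t r -> (exists2 i, (i <= r)%N & x = t i) \/ g x < 1.
  move=> /andP[x0 xr].
  suff: forall j, (j <= r)%N -> x <= t j ->
      (exists2 i, (i <= r)%N & x = t i) \/ g x < 1 by move/(_ r (leqnn r) xr).
  elim=> [_ xt|j IH jr xt].
    by left; exists 0%N => //; apply/eqP; rewrite eq_le xt t0 x0.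
  case: (leP x (t j)) => [xj|jx]; first exact: IH (ltnW jr) xj.
  move: xt; rewrite le_eqVlt => /orP[/eqP ->|xj]; first by left; exists j.+1.
  by right; apply: (g_gap j) => //; rewrite jx.
exists g => // x /andP[x0 x2].
suff [[i ir ->]|gx] : (exists2 i, (i <= r)%N & x = t i) \/ g x < 1.
  by rewrite gt1//; split=> //; split=> // _; exists i.
  split; first exact: ltW.
  by split=> [gx1|[i ir xi]]; [rewrite gx1 ltxx in gx|rewrite xi gt1// ltxx in gx].
case: (leP x (t r)) => [xr|rx]; first by apply: g_left; rewrite x0.
right; case: (ltP x pi) => [xpi|pix].
  by have /andP[] : -1 < g x < 1 by apply: g_right; rewrite rx.
(* On the second half-turn the upper bound for [g] is the lower bound -1 at [x - pi]. *)
rewrite -[x](subrK pi) gpi ltrNl.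
case: (leP (x - pi) (t r)) => [xr|rx']; first by apply: g_gtN1; lra.
by have /andP[] : -1 < g (x - pi) < 1 by apply: g_right; lra.
Qed.
End Points.
End LocalNeighborliness.

(** * Linear functionals on the curve *)

Section OddTrig.
Variable R : realType.
Implicit Types (f g h : R -> R) (a b c x y z : R).

(** These are the pull-backs of linear functionals under the curve [U_q]. Indexing the coefficients
    by [nat] avoids casts when [q] changes. *)
Definition oddtrig (q : nat) f := exists A B : nat -> R, forall x,
  f x = \sum_(l < q) (A l * cos (l.*2.+1%:R * x) + B l * sin (l.*2.+1%:R * x)).

Lemma eq_oddtrig q f g : f =1 g -> oddtrig q f -> oddtrig q g.
Proof. by move=> fg [A [B E]]; exists A, B => x; rewrite -fg. Qed.

Lemma oddtrig_lin q c f g : oddtrig q f -> oddtrig q g ->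
  oddtrig q (fun x => c * f x + g x).
Proof.
move=> [A [B fE]] [A' [B' gE]].
exists (fun l => c * A l + A' l), (fun l => c * B l + B' l) => x.
by rewrite fE gE mulr_sumr -big_split; apply: eq_bigr => l _ /=; ring.
Qed.

Lemma oddtrig0 q : oddtrig q (fun=> 0).
Proof. by exists (fun=> 0), (fun=> 0) => x; rewrite big1// => l _; ring. Qed.

Lemma oddtrigZ q c f : oddtrig q f -> oddtrig q (fun x => c * f x).
Proof.
by move=> F; apply: eq_oddtrig (oddtrig_lin c F (oddtrig0 q)) => x; rewrite addr0.
Qed.

Lemma oddtrigD q f g : oddtrig q f -> oddtrig q g -> oddtrig q (fun x => f x + g x).
Proof.
by move=> F G; apply: eq_oddtrig (oddtrig_lin 1 F G) => x; rewrite mul1r.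
Qed.

Lemma oddtrig_sum q n (F : nat -> R -> R) :
  (forall l, (l < n)%N -> oddtrig q (F l)) -> oddtrig q (fun x => \sum_(l < n) F l x).
Proof.
elim: n => [|n IH] H.
  by apply: eq_oddtrig (oddtrig0 q) => x; rewrite big_ord0.
apply: (eq_oddtrig (f := fun x => \sum_(l < n) F l x + F n x)).
  by move=> x; rewrite big_ord_recr.
by apply: oddtrigD; [apply: IH => l ln; apply/H/leqW|apply: H].
Qed.

Lemma oddtrig_cos q l : (l < q)%N -> oddtrig q (fun x => cos (l.*2.+1%:R * x)).
Proof.
move=> lq; exists (fun j => (j == l)%:R), (fun=> 0) => x.
rewrite (bigD1 (Ordinal lq))//= eqxx big1 => [|j /negPf]; last first.
  by rewrite -val_eqE /= => -> /=; ring.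
by rewrite /=; ring.

Qed.

Lemma oddtrig_sin q l : (l < q)%N -> oddtrig q (fun x => sin (l.*2.+1%:R * x)).
Proof.
move=> lq; exists (fun=> 0), (fun j => (j == l)%:R) => x.
rewrite (bigD1 (Ordinal lq))//= eqxx big1 => [|j /negPf]; last first.
  by rewrite -val_eqE /= => -> /=; ring.
by rewrite /=; ring.

Qed.

(** The frequency 2l + 1 moves to 2l + 3 or 2l - 1. For [l = 0] the latter is -1, which parity folds
    back to 1. *)
Lemma oddtrig_shift q l : (l < q)%N ->
  [/\ oddtrig q.+1 (fun x => cos (l.*2.+1%:R * x + 2 * x)),
      oddtrig q.+1 (fun x => sin (l.*2.+1%:R * x + 2 * x)),
      oddtrig q.+1 (fun x => cos (l.*2.+1%:R * x - 2 * x)) &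
      oddtrig q.+1 (fun x => sin (l.*2.+1%:R * x - 2 * x))].
Proof.
move=> lq.
have E j x : j.+1.*2.+1%:R * x = j.*2.+1%:R * x + 2 * x.
  by rewrite -mulrDl -natrD addn2.
split.
- by apply: eq_oddtrig (@oddtrig_cos q.+1 l.+1 lq) => x; rewrite E.
- by apply: eq_oddtrig (@oddtrig_sin q.+1 l.+1 lq) => x; rewrite E.
- case: l lq => [|l] lq.
    by apply: eq_oddtrig (@oddtrig_cos q.+1 0 (leqW lq)) => x; rewrite double0 -[in LHS]cosN; congr cos; ring.
  by apply: eq_oddtrig (@oddtrig_cos q.+1 l (leqW (ltnW lq))) => x; rewrite E addrK.
- case: l lq => [|l] lq.
    apply: eq_oddtrig (oddtrigZ (-1) (@oddtrig_sin q.+1 0 (leqW lq))) => x.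
    by rewrite double0 mulN1r -sinN; congr sin; ring.
  by apply: eq_oddtrig (@oddtrig_sin q.+1 l (leqW (ltnW lq))) => x; rewrite E addrK.
Qed.

Lemma oddtrig_cos2M q f : oddtrig q f -> oddtrig q.+1 (fun x => cos (2 * x) * f x).
Proof.
move=> [A [B fE]].
pose F l x := A l / 2 * cos (l.*2.+1%:R * x + 2 * x) +
  (A l / 2 * cos (l.*2.+1%:R * x - 2 * x) +
  (B l / 2 * sin (l.*2.+1%:R * x + 2 * x) + B l / 2 * sin (l.*2.+1%:R * x - 2 * x))).
apply: (eq_oddtrig (f := fun x => \sum_(l < q) F l x)).
  move=> x; rewrite fE mulr_sumr; apply: eq_bigr => l _.
  by rewrite /F cosD cosB sinD sinB; field.
apply: oddtrig_sum => l /oddtrig_shift[cp sp cm sm].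
by do !(apply: oddtrigD || apply: oddtrigZ).
Qed.

Lemma oddtrig_sin2M q f : oddtrig q f -> oddtrig q.+1 (fun x => sin (2 * x) * f x).
Proof.
move=> [A [B fE]].
pose F l x := A l / 2 * sin (l.*2.+1%:R * x + 2 * x) +
  (- A l / 2 * sin (l.*2.+1%:R * x - 2 * x) +
  (- B l / 2 * cos (l.*2.+1%:R * x + 2 * x) + B l / 2 * cos (l.*2.+1%:R * x - 2 * x))).
apply: (eq_oddtrig (f := fun x => \sum_(l < q) F l x)).
  move=> x; rewrite fE mulr_sumr; apply: eq_bigr => l _.
  by rewrite /F cosD cosB sinD sinB; field.
apply: oddtrig_sum => l /oddtrig_shift[cp sp cm sm].
by do !(apply: oddtrigD || apply: oddtrigZ).
Qed.

Lemma oddtrigS q f : oddtrig q f -> oddtrig q.+1 f.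
Proof.
move=> [A [B fE]].
apply: (eq_oddtrig (f := fun x => \sum_(l < q)
   (A l * cos (l.*2.+1%:R * x) + B l * sin (l.*2.+1%:R * x)))) => [x|]; first by rewrite fE.
apply: (@oddtrig_sum _ _ (fun l x => A l * cos (l.*2.+1%:R * x) + B l * sin (l.*2.+1%:R * x))).
move=> l lq; apply: oddtrigD; apply: oddtrigZ.
  by apply/oddtrig_cos/leqW.
by apply/oddtrig_sin/leqW.
Qed.

Lemma oddtrig_le q q' f : (q <= q')%N -> oddtrig q f -> oddtrig q' f.
Proof.
by move=> /subnK <-; elim: (q' - q)%N => // e IH F; rewrite addSn; apply/oddtrigS/IH.
Qed.

(** Two levels of the recursion multiply by products of two of [cos x] and [sin x]. By the
    double-angle formulas these are combinations of 1, [cos (2 * x)] and [sin (2 * x)], which raise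
    odd frequencies by at most 2. *)
Lemma tform_oddtrig q f : tform q.*2.+1 f -> oddtrig q.+1 f.
Proof.
elim: q f => [|q IH] f.
  move=> [f1 [f2 [[a f1E] [b f2E] fE]]].
  apply: (eq_oddtrig (f := fun x => a * cos (0.*2.+1%:R * x) + b * sin (0.*2.+1%:R * x))).
    by move=> x; rewrite fE f1E f2E !mul1r; ring.
  apply: oddtrigD; apply: oddtrigZ; first exact: oddtrig_cos.
  exact: oddtrig_sin.
rewrite doubleS => -[g [h [[f1 [f2 [F1 F2 gE]]] [f3 [f4 [F3 F4 hE]]] fE]]].
apply: (eq_oddtrig (f := fun x => (2^-1 * f1 x + 2^-1 * (cos (2 * x) * f1 x)) +
   ((2^-1 * (sin (2 * x) * f2 x) + 2^-1 * (sin (2 * x) * f3 x)) +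
    (2^-1 * f4 x + - 2^-1 * (cos (2 * x) * f4 x))))).
  move=> x; rewrite fE gE hE.
  have -> : 2 * x = x + x by ring.
  rewrite cosD sinD; have := cos2Dsin2 x => cs.
  apply/eqP; rewrite -subr_eq0; apply/eqP.
  transitivity ((1 - (cos x ^+ 2 + sin x ^+ 2)) * (f1 x + f4 x) / 2).
    by field.
  by rewrite cs subrr !mul0r.
by do !apply: oddtrigD; apply: oddtrigZ;
  (apply: oddtrig_cos2M || apply: oddtrig_sin2M || apply: oddtrigS); apply: IH.
Qed.

Variables k m : nat.

(* f is the pull-back to the curve of a linear functional. *)
Definition lin (f : R -> R) :=
  exists c : 'rV[R]_(6 * k * m.+1), forall x, f x = dotv c (Psi k m x).

Lemma lin_lin a f g : lin f -> lin g -> lin (fun x => a * f x + g x).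
Proof.
move=> [c fE] [c' gE]; exists (a *: c + c') => x; rewrite fE gE /dotv mulr_sumr.
by rewrite -big_split; apply: eq_bigr => i _ /=; rewrite !mxE; ring.
Qed.

Lemma lin0 : lin (fun=> 0).
Proof. by exists 0 => x; rewrite /dotv big1// => i _; rewrite mxE mul0r. Qed.

(** The coordinate of index [b * (6 * k) + l.*2 + e] is the cosine for [e = 0] and the sine for
    [e = 1]. *)
Lemma lin_freq (l b : nat) : (l < 3 * k)%N -> (b <= m)%N ->
  lin (fun x => cos ((l.*2.+1 * 5 ^ b)%:R * x)) /\
  lin (fun x => sin ((l.*2.+1 * 5 ^ b)%:R * x)).
Proof.
move=> lk bm.
have H (e : nat) : (e < 2)%N -> (b * (6 * k) + (l.*2 + e) < 6 * k * m.+1)%N by nia.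
have H' (e : nat) : (e < 2)%N -> (l.*2 + e < 6 * k)%N by lia.
have D (e : nat) (i : 'I_(6 * k * m.+1)) x : (e < 2)%N -> i = (b * (6 * k) + (l.*2 + e))%N :> nat ->
   dotv (delta_mx 0 i) (Psi k m x) =
   if odd e then sin ((l.*2.+1 * 5 ^ b)%:R * x) else cos ((l.*2.+1 * 5 ^ b)%:R * x).
  move=> e2 iE; rewrite /dotv (bigD1 i)//= big1 => [|j ji]; last first.
    by rewrite mxE (negPf ji) mul0r.
  rewrite addr0 !mxE !eqxx mul1r iE.
  have k0 : (0 < 6 * k)%N by lia.
  have -> : ((b * (6 * k) + (l.*2 + e)) %/ (6 * k) = b)%N.
    by rewrite divnMDl// (divn_small (H' e e2)) addn0.
  rewrite modnMDl (modn_small (H' e e2)).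
  cbv zeta.
  have -> : (((l.*2 + e) %/ 2) = l)%N by lia.
  by have -> : odd (l.*2 + e) = odd e by rewrite oddD odd_double.
split; first by exists (delta_mx 0 (Ordinal (H 0%N isT))) => x; rewrite (D 0%N).
by exists (delta_mx 0 (Ordinal (H 1%N isT))) => x; rewrite (D 1%N).
Qed.

Lemma lin_oddtrig (b : nat) f : (b <= m)%N -> oddtrig (3 * k) f ->
  lin (fun x => f ((5 ^ b)%:R * x)).
Proof.
move=> bm [A [B fE]].
suff: forall q, (q <= 3 * k)%N -> lin (fun x => \sum_(l < q)
   (A l * cos (l.*2.+1%:R * ((5 ^ b)%:R * x)) + B l * sin (l.*2.+1%:R * ((5 ^ b)%:R * x)))).
  by move=> /(_ _ (leqnn _)) [c cE]; exists c => x; rewrite fE cE.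
elim=> [_|q IH qk]; first by have [c cE] := lin0; exists c => x; rewrite -cE big_ord0.
have [Lc Ls] := lin_freq qk bm.
have [c cE] := lin_lin (A q) Lc (lin_lin (B q) Ls (IH (ltnW qk))).
by exists c => x; rewrite -cE big_ord_recr /= !mulrA -!natrM; ring.
Qed.

Lemma lin_tform (b q : nat) a f : (b <= m)%N -> (q < 3 * k)%N -> tform q.*2.+1 f ->
  lin (fun x => f ((5 ^ b)%:R * x - a)).
Proof.
move=> bm qk /(tform_shift a)/tform_oddtrig/(oddtrig_le qk).
exact: lin_oddtrig.
Qed.

End OddTrig.

(** * Faces and affine dimension of convex hulls *)

Section Polytopes.
Variable R : realType.

Lemma dotv_sumr N M (c : 'rV[R]_N) (l : 'I_M -> R) (p : 'I_M -> 'rV[R]_N) :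
  dotv c (\sum_j l j *: p j) = \sum_j l j * dotv c (p j).
Proof.
rewrite /dotv.
transitivity (\sum_i \sum_j l j * (c 0 i * p j 0 i)).
  apply: eq_bigr => i _; rewrite summxE mulr_sumr.
  by apply: eq_bigr => j _; rewrite !mxE; ring.
by rewrite exchange_big; apply: eq_bigr => j _; rewrite mulr_sumr.
Qed.

Lemma dotv0l N (x : 'rV[R]_N) : dotv 0 x = 0.
Proof. by rewrite /dotv big1// => i _; rewrite mxE mul0r. Qed.

Lemma conv_point N M (p : 'I_M -> 'rV[R]_N) j : conv p (p j).
Proof.
exists (fun i => (i == j)%:R); split=> [i|]; first by rewrite ler0n.
by split; rewrite (bigD1 j)//= eqxx ?scale1r big1 ?addr0// => i /negPf -> ; rewrite ?scale0r.
Qed.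

Lemma conv_le N M (p : 'I_M -> 'rV[R]_N) c B :
  (forall j, dotv c (p j) <= B) -> forall x, conv p x -> dotv c x <= B.
Proof.
move=> cB x [l [l0 [l1 ->]]]; rewrite dotv_sumr -[leRHS]mul1r -l1 mulr_suml.
by apply: ler_sum => j _; exact: ler_wpM2l.
Qed.

(* A convex combination attains the maximum only if it is supported on the maximizing points. *)
Lemma conv_eq_support N M (p : 'I_M -> 'rV[R]_N) c B (l : 'I_M -> R) :
    (forall j, dotv c (p j) <= B) -> (forall j, 0 <= l j) -> \sum_j l j = 1 ->
  dotv c (\sum_j l j *: p j) = B -> forall j, dotv c (p j) != B -> l j = 0.
Proof.
move=> cB l0 l1 E j cj.
have : \sum_j l j * (B - dotv c (p j)) = 0.
  rewrite (eq_bigr (fun j => l j * B - l j * dotv c (p j))) => [|i _]; last by ring.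
  by rewrite sumrB -mulr_suml l1 mul1r -dotv_sumr E subrr.
move/psumr_eq0P => /(_ (fun i _ => mulr_ge0 (l0 i) _)) H.
have /eqP := H (fun i => eq_ind_r _ (cB i) (subr_ge0 _ _)) j isT.
by rewrite mulf_eq0 subr_eq0 [B == _]eq_sym (negPf cj) orbF => /eqP.
Qed.

(** Weights are pushed forward along [f] one way and along a section of [f] the other way, so
    repeated points are allowed. Positivity of [B] ensures [c != 0]. *)
Lemma is_face_conv N M k (p : 'I_M -> 'rV[R]_N) (f : 'I_k -> 'I_M) c B :
    (0 < k)%N -> 0 < B -> (forall j, dotv c (p j) <= B) ->
    (forall j, dotv c (p j) = B <-> exists i, f i = j) ->
  is_face (conv p) (conv (fun i => p (f i))).
Proof.
move=> k0 B0 cB cBE; pose i0 := Ordinal k0.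
have cf i : dotv c (p (f i)) = B by apply/cBE; exists i.
exists c, B; split.
  by apply/eqP => c0; move: B0; rewrite -(cf i0) c0 dotv0l ltxx.
split; first exact: conv_le.
split; first by exists (p (f i0)); split; [exact: conv_point|exact: cf].
apply/seteqP; split=> x.
  move=> [l [l0 [l1 ->]]]; split; last first.
    rewrite dotv_sumr (eq_bigr (fun j => l j * B)) => [|i _]; last by rewrite cf.
    by rewrite -mulr_suml l1 mul1r.
  exists (fun j => \sum_(i | f i == j) l i); split=> [j|]; first exact: sumr_ge0.
  split; first by rewrite -l1 [RHS](partition_big f predT).
  rewrite (partition_big f predT)//=; apply: eq_bigr => j _.
  by rewrite scaler_suml; apply: eq_bigr => i /eqP ->.
move=> [[l [l0 [l1 ->]]] cx].
pose g j := odflt i0 [pick i | f i == j].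
have gK j : dotv c (p j) = B -> f (g j) = j.
  move=> /cBE[i fi]; rewrite /g; case: pickP => [i' /eqP //|/(_ i)].
  by rewrite fi eqxx.
have lS := conv_eq_support cB l0 l1 cx.
exists (fun i => \sum_(j | g j == i) l j); split=> [i|]; first exact: sumr_ge0.
split; first by rewrite -l1 [RHS](partition_big g predT).
rewrite (partition_big g predT)//=; apply: eq_bigr => i _.
rewrite scaler_suml; apply: eq_bigr => j /eqP <-.
by have [/gK -> //|/lS ->] := eqVneq (dotv c (p j)) B; rewrite !scale0r.
Qed.

(** The exposing functional attains its maximum at some generator, for otherwise all weights of the
    vertex would vanish; the face being a singleton, that generator is the vertex. *)
Lemma vertex_conv N M (p : 'I_M -> 'rV[R]_N) v :
  is_vertex (conv p) v -> exists j, v = p j.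
Proof.
move=> [c [B [_ [cB [[x [[l [l0 [l1 xE]]] cx]] F]]]]].
have cBp j : dotv c (p j) <= B by apply: cB; exact: conv_point.
rewrite xE in cx; have lS := conv_eq_support cBp l0 l1 cx.
case: (pselect (exists j, dotv c (p j) = B)) => [[j cj]|nj].
  exists j; have : [set x | conv p x /\ dotv c x = B] (p j).
    by split=> //; exact: conv_point.
  by rewrite -F => ->.
have : \sum_j l j = 0.
  by rewrite big1// => j _; apply: lS; apply/eqP => cj; apply: nj; exists j.
by rewrite l1 => /eqP; rewrite oner_eq0.
Qed.

Lemma conv_opp N M (p : 'I_M -> 'rV[R]_N) (s : 'I_M -> 'I_M) :
  (forall j, p (s j) = - p j) -> forall x, conv p x -> conv p (- x).
Proof.
move=> ps x [l [l0 [l1 ->]]].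
exists (fun j => \sum_(i | s i == j) l i); split=> [j|]; first exact: sumr_ge0.
split; first by rewrite -l1 [RHS](partition_big s predT).
rewrite -sumrN (partition_big s predT)//=; apply: eq_bigr => j _.
by rewrite scaler_suml; apply: eq_bigr => i /eqP <-; rewrite ps scalerN.
Qed.

Lemma conv1 N (p : 'I_1 -> 'rV[R]_N) : conv p = [set p ord0].
Proof.
apply/seteqP; split=> x /=; last by move=> ->; exact: conv_point.
by move=> [l [_ []]]; rewrite !big_ord1 => -> ->; rewrite scale1r.
Qed.

Lemma affdim_le N (K : set 'rV[R]_N) (V : 'M[R]_N) d :
    (\rank V <= d)%N -> (forall x y, K x -> K y -> (x - y <= V)%MS) ->
  (affdim K <= d)%N.
Proof.
move=> Vd KV; apply: leq_trans Vd.
have rV : (\rank V < N.+1)%N by rewrite ltnS rank_leq_row.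
rewrite /affdim; set P := BIG_P.
have PV : P (Ordinal rV) by apply/asboolP; exists V.
have : Ordinal rV \in index_enum 'I_N.+1 by rewrite mem_index_enum.
elim: index_enum => // i s IH; rewrite inE big_cons => /orP[/eqP <-|/IH le_s].
  by rewrite PV geq_minl.
by case: ifP => // _; apply: leq_trans le_s; exact: geq_minr.
Qed.

(** The minimum defining [affdim] starts from the value [N], hence the hypothesis [d <= N]. *)
Lemma affdim_ge N (K : set 'rV[R]_N) d : (d <= N)%N ->
    (forall V : 'M[R]_N, (forall x y, K x -> K y -> (x - y <= V)%MS) -> (d <= \rank V)%N) ->
  (d <= affdim K)%N.
Proof.
move=> dN H; rewrite /affdim; elim/big_ind: _ => // [a b da db|i /asboolP[V [<- /H //]]].
by rewrite leq_min da.
Qed.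
End Polytopes.

(** * Exposing the faces *)

Section Angles.
Variable R : realType.
Implicit Types (f : R -> R) (x : R) (z w : int).

Lemma tform_periodic d f x w : tform d f -> f (x + 2 * pi * w%:~R) = f x.
Proof.
move=> F.
have P y : f (y + 2 * pi) = f y.
  rewrite mulr_natl mulr2n addrA !(tformDpi _ F).
  by rewrite mulrA -exprD addnn -mul2n exprM sqrrN !expr1n mul1r.
have PN y (v : nat) : f (y + 2 * pi * v%:R) = f y.
  elim: v => [|v IH]; first by rewrite mulr0 addr0.
  by rewrite -[v.+1%:R]natr1 mulrDr mulr1 addrA P IH.
case: w => v; first by rewrite -pmulrn PN.
by rewrite NegzE mulrNz mulrN -[in RHS](subrK (2 * pi * v.+1%:R) x) PN.
Qed.

(** Reducing [z] mod [M] changes the sine at most by a sign, and a residue strictly between 0 and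
    [M] gives an angle in (0, pi), where the sine is positive. *)
Lemma sin_pi_frac_eq0 (M : nat) z : (0 < M)%N ->
  sin (pi * z%:~R / M%:R : R) = 0 -> (M %| z)%Z.
Proof.
move=> M0; have M0' : (M%:R : R) != 0 by rewrite pnatr_eq0 -lt0n.
have snat (v : nat) : sin (pi * v%:R : R) = 0.
  elim: v => [|v IH]; first by rewrite mulr0 sin0.
  by rewrite -natr1 mulrDr mulr1 sinDpi IH oppr0.
have sint (w : int) : sin (pi * w%:~R : R) = 0.
  by case: w => v; rewrite ?NegzE ?mulrNz ?mulrN ?sinN ?snat ?oppr0// -pmulrn snat.
set q := (z %/ M)%Z; set r := (z %% M)%Z.
have zE : z = q * M%:Z + r by rewrite /q /r -divz_eq.
have r0 : 0 <= r by rewrite /r modz_ge0; lia.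
have rM : r < M%:Z by rewrite /r ltz_pmod; lia.
have -> : pi * z%:~R / M%:R = pi * r%:~R / M%:R + pi * q%:~R :> R.
  by rewrite zE intrD intrM -pmulrn; field.
rewrite sinD sint mulr0 addr0 => /eqP; rewrite mulf_eq0 => /orP[/eqP s0|/eqP c0]; last first.
  by have := cos2Dsin2 (pi * q%:~R : R); rewrite sint c0 expr0n addr0 => /eqP; rewrite eq_sym oner_eq0.
suff r00 : r = 0 by apply/dvdzP; exists q; rewrite {1}zE r00 addr0.
apply/eqP; rewrite eq_le r0 andbT leNgt; apply/negP => rpos.
have p0 := pi_gt0 R.
have rR : (0 : R) < r%:~R by rewrite ltr0z.
have MR : (0 : R) < M%:R by rewrite ltr0n.
have : 0 < sin (pi * r%:~R / M%:R : R).
  apply: sin_gt0_pi; rewrite divr_gt0 ?mulr_gt0//= ltr_pdivrMr//.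
  by rewrite ltr_pM2l// pmulrn ltr_int.
by rewrite s0 ltxx.
Qed.

(** Integer arguments make differences and residues of indices available. *)
Definition theta (M : nat) z : R := 2 * pi * z%:~R / M%:R.

Lemma theta_modz M d f z : (0 < M)%N -> tform d f ->
  f (theta M z) = f (theta M (z %% M)%Z).
Proof.
move=> M0 F; rewrite {1}(divz_eq z M).
rewrite -(tform_periodic (theta M (z %% M)%Z) (z %/ M)%Z F); congr f.
rewrite /theta intrD intrM -pmulrn; field.
by rewrite pnatr_eq0 -lt0n.
Qed.

Lemma theta_inj M : (0 < M)%N -> injective (theta M).
Proof.
move=> M0 z w /(congr1 (fun x => x * M%:R / (2 * pi))).
have p0 : (pi : R) != 0 by rewrite gt_eqF// pi_gt0.
have M0' : (M%:R : R) != 0 by rewrite pnatr_eq0 -lt0n.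
rewrite /theta.
have E (u : R) : 2 * pi * u / M%:R * M%:R / (2 * pi) = u.
  by rewrite divfK// mulrAC mulfV ?mul1r// mulf_neq0 ?pnatr_eq0.
by rewrite !E => /eqP; rewrite eqr_int => /eqP.
Qed.

Lemma thetaB M z w : theta M (z - w) = theta M z - theta M w.
Proof. by rewrite /theta intrB mulrBr mulrBl. Qed.

Lemma sin_theta_eq0 M z : (0 < M)%N -> sin (theta M z) = 0 -> (M %| 2 * z)%Z.
Proof.
move=> M0 s0; apply: sin_pi_frac_eq0 => //; rewrite -{}s0; congr sin.
by rewrite /theta intrM; congr (_ / _); ring.
Qed.

Lemma cos_theta_eq1 M z : (0 < M)%N -> cos (theta M z) = 1 -> (M %| z)%Z.
Proof.
move=> M0 c1; apply: sin_pi_frac_eq0 => //.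
set y := pi * z%:~R / M%:R; have : cos (y + y) = 1.
  by rewrite -c1; congr cos; rewrite /y /theta -mulrDl; congr (_ / _); ring.
rewrite cosD -!expr2 cos2sin2 => E.
have /eqP : 2 * sin y ^+ 2 = 0 by move: E; lra.
by rewrite mulf_eq0 pnatr_eq0 /= sqrf_eq0 => /eqP.
Qed.
End Angles.

(** * Descent through the powers of 5 *)

Section Faces.
Variables (R : realType) (k m n : nat).
Hypotheses (k_gt0 : (0 < k)%N) (n_gt0 : (0 < n)%N).
Local Notation M := (n * 5 ^ m)%N.
Local Notation pt := (fun j : 'I_M => Psi k m (tA m n j) : 'rV[R]_(6 * k * m.+1)).
Variable f : 'I_k -> 'I_M.

Lemma M_gt0 : (0 < M)%N. Proof. by rewrite muln_gt0 n_gt0 expn_gt0. Qed.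

Lemma tA_theta (j : nat) : tA m n j = theta R M j.
Proof. by rewrite /tA /theta -pmulrn. Qed.

Lemma expn_tA_theta c (j : nat) (a : int) :
  (5 ^ c)%:R * tA m n j - theta R M a = theta R M ((5 ^ c)%:Z * j - a).
Proof.
rewrite tA_theta /theta intrB intrM -!pmulrn mulrBr mulrBl; congr (_ - _).
by rewrite !mulrA; congr (_ / _); ring.
Qed.

(** The divisibility says that 5 ^ c times the two points agree mod 2 pi. At level 0 only the chosen
    points themselves satisfy it. *)
Definition exposed c := exists psi B, [/\ lin k m psi, 0 < B :> R,
  forall j : 'I_M, psi (tA m n j) <= B &
  forall j : 'I_M, psi (tA m n j) = B <->
    exists i, (M %| (5 ^ c)%:Z * (j%:Z - (f i)%:Z))%Z].

Lemma exposed_face : exposed 0 -> is_face (Pkmn k m n) (conv (fun i => pt (f i))).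
Proof.
move=> [psi [B [[c cE] B0 psiB psiE]]].
apply: (is_face_conv (p := pt) (c := c) k_gt0 B0) => j; rewrite -cE//.
split=> [/psiE[i]|[i <-]]; last by apply/psiE; exists i; rewrite subrr mulr0 dvdz0.
rewrite expn0 mul1r => dv; exists i; apply/val_inj => /=.
have := ltn_ord j; have := ltn_ord (f i); case/dvdzP: dv => q E ? ?.
have : q = 0 by nia.
by move=> q0; move: E; rewrite q0 mul0r; lia.
Qed.

Let i0 := Ordinal k_gt0.

(** The arc has to begin at the point of index [i0]: residues then start from 0, and the lifts
    counted later come from the five choices of the first coordinate. *)
Definition clustered c := forall i,
  5 * (((5 ^ c)%:Z * ((f i)%:Z - (f i0)%:Z)) %% M)%Z < M%:Z.

(** The distinct residues, sorted, start at 0 and stay below a fifth of a turn, so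
    [local_neighborliness] applies. There are at most [k] of them, so the form has degree at most 2k
    - 1 and fits in one block. *)
Lemma clustered_exposed c : (c <= m)%N -> clustered c -> exposed c.
Proof.
move=> cm cl; have M0 := M_gt0.
pose D (j : 'I_M) := (((5 ^ c)%:Z * (j%:Z - (f i0)%:Z)) %% M)%Z.
have D0 j : 0 <= D j by rewrite /D modz_ge0; lia.
have DM j : D j < M by rewrite /D ltz_pmod; lia.
pose s := sort leq (undup [seq `|D (f i)|%N | i <- enum 'I_k]).
have sP (d : nat) : d \in s -> exists i, d = `|D (f i)|%N.
  by rewrite mem_sort mem_undup => /mapP[i _ ->]; exists i.
have sD i : `|D (f i)|%N \in s by rewrite mem_sort mem_undup; apply/mapP; exists i; rewrite ?mem_enum.
have size_s : (0 < size s <= k)%N.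
  apply/andP; split; first by have := sD i0; case: s {sP sD}.
  rewrite size_sort (leq_trans (size_undup _))// size_map.
  by rewrite -[X in (_ <= X)%N]card_ord -cardE.
have s_sorted : sorted ltn s.
  by rewrite ltn_sorted_uniq_leq sort_uniq undup_uniq sort_sorted//; exact: leq_total.
pose t i : R := theta R M (nth 0%N s i).
clearbody s; case/andP: size_s => s_gt0 s_le.
have pi0 := pi_gt0 R; have MR : (0 : R) < M%:R by rewrite ltr0n.
have theta_lt z w : z < w -> theta R M z < theta R M w.
  by move=> zw; rewrite /theta ltr_pM2r ?invr_gt0// ltr_pM2l ?ltr_int// mulr_gt0.
have [g G gE] : exists2 g, tform (size s).-1.*2.+1 g &
  forall x, 0 <= x < 2 * pi -> g x <= 1 /\
    (g x = 1 <-> exists2 i, (i <= (size s).-1)%N & x = t i).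
  apply: local_neighborliness.
  - move=> i j /andP[ij jr]; apply: theta_lt; rewrite ltz_nat.
    by apply: (sorted_ltn_nth ltn_trans) => //; rewrite inE; lia.
  - have : 0%N \in s by have := sD i0; rewrite /D subrr mulr0 mod0z.
    move=> /(nthP 0%N)[i ilt i_0]; rewrite /t.
    suff -> : nth 0%N s 0 = 0%N by rewrite /theta mulr0 mul0r.
    case: (posnP i) => [i_eq|ipos]; first by rewrite -[in RHS]i_0 i_eq.
    have := sorted_ltn_nth ltn_trans 0%N s_sorted 0%N i.
    by rewrite !inE ilt i_0 => /(_ _ isT ipos); rewrite (leq_trans _ ilt)// => /(_ isT).
  - have [|i iE] := sP (nth 0%N s (size s).-1).
      by rewrite mem_nth// ltn_predL.
    rewrite /t iE /theta ltr_pdivrMr// gez0_abs//.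
    have : (5 * D (f i))%:~R < (M%:Z)%:~R :> R by rewrite ltr_int cl.
    by rewrite intrM -pmulrn; nra.
exists (fun x => g ((5 ^ c)%:R * x - theta R M ((5 ^ c)%:Z * (f i0)%:Z))), 1.
have gj (j : 'I_M) : g ((5 ^ c)%:R * tA m n j - theta R M ((5 ^ c)%:Z * (f i0)%:Z)) = g (theta R M (D j)).
  by rewrite expn_tA_theta -mulrBr (theta_modz _ M0 G).
have itv j : 0 <= theta R M (D j) < 2 * pi.
  rewrite /theta; apply/andP; split.
    by rewrite divr_ge0 ?mulr_ge0 ?ler0z ?ler0n ?(ltW pi0).
  rewrite ltr_pdivrMr//.
  by rewrite ltr_pM2l ?mulr_gt0// pmulrn ltr_int.
split=> //.
- by apply: (@lin_tform _ _ _ c _ _ _ cm _ G); lia.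
- by move=> j; rewrite gj; have [] := gE _ (itv j).
- move=> j; rewrite gj; have [_ E] := gE _ (itv j); rewrite {}E.
  have DE i : (D j == D (f i)) = (M %| (5 ^ c)%:Z * (j%:Z - (f i)%:Z))%Z.
    by rewrite /D eqz_mod_dvd -mulrBr opprB addrA subrK.
  split.
    move=> [i ir /(theta_inj M0) Dj].
    have [|l lE] := sP (nth 0%N s i).
      by rewrite mem_nth// (leq_ltn_trans ir)// ltn_predL.
    by exists l; rewrite -DE Dj lE gez0_abs.
  move=> [i]; rewrite -DE => /eqP Dj; have /(nthP 0%N)[l ls lE] := sD i.
  by exists l; [rewrite -ltnS prednK|rewrite /t lE gez0_abs// Dj].
Qed.

(** Forms of odd degree take opposite values at antipodes, so interpolation needs this condition. *)
Definition no_antipodes c := forall i i',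
  (M %| 2 * ((5 ^ c)%:Z * ((f i)%:Z - (f i')%:Z)))%Z ->
  (M %| (5 ^ c)%:Z * ((f i)%:Z - (f i')%:Z))%Z.

(** Two residues in [0, M / 5) have a difference whose double is smaller than [M] in absolute
    value. *)
Lemma clustered_no_antipodes c : clustered c -> no_antipodes c.
Proof.
move=> cl i i'; have M0 := M_gt0.
set x := (5 ^ c)%:Z * ((f i)%:Z - (f i0)%:Z); set y := (5 ^ c)%:Z * ((f i')%:Z - (f i0)%:Z).
have -> : (5 ^ c)%:Z * ((f i)%:Z - (f i')%:Z) = x - y by rewrite -mulrBr opprB addrA subrK.
have [cx cy] : 5 * (x %% M)%Z < M%:Z /\ 5 * (y %% M)%Z < M%:Z by split; exact: cl.
have x0 : 0 <= (x %% M)%Z by rewrite modz_ge0; lia.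
have y0 : 0 <= (y %% M)%Z by rewrite modz_ge0; lia.
rewrite -eqz_mod_dvd.
have E : x - y = ((x %/ M)%Z - (y %/ M)%Z) * M%:Z + ((x %% M)%Z - (y %% M)%Z).
  by rewrite {1}(divz_eq x M) {1}(divz_eq y M); ring.
rewrite {}E mulrDr mulrA => dv.
have : (M %| 2 * ((x %% M)%Z - (y %% M)%Z))%Z by move: dv; rewrite rpredDl// dvdz_mull.
case/dvdzP => q.
move: cx cy x0 y0; set a := (x %% M)%Z; set b := (y %% M)%Z => cx cy a0 b0 E.
have q0 : q = 0 by nia.
by apply/eqP; move: E; rewrite q0 mul0r; lia.
Qed.

(* If M divides 2x and 5x, it divides x = 5x - 2 (2x). *)
Lemma no_antipodesW c : no_antipodes c.+1 -> no_antipodes c.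
Proof.
move=> H i i'; set u := (f i)%:Z - (f i')%:Z => dv.
have E : (5 ^ c.+1)%:Z * u = 5 * ((5 ^ c)%:Z * u) by rewrite expnS PoszM mulrA.
have : (M %| (5 ^ c.+1)%:Z * u)%Z.
  by apply: H; rewrite -/u E mulrCA dvdz_mull.
rewrite E => dv5.
have -> : (5 ^ c)%:Z * u = 5 * ((5 ^ c)%:Z * u) - 2 * (2 * ((5 ^ c)%:Z * u)) by ring.
by apply: rpredB => //; apply: dvdz_mull.
Qed.

(* A large multiple of psi dominates the interpolating form off the face exposed by psi. *)
Lemma exposed_step c : (0 < m)%N -> (c <= m)%N -> no_antipodes c.+1 ->
  exposed c.+1 -> exposed c.
Proof.
move=> m0 cm na [psi [B [Lpsi B0 psiB psiE]]]; have M0 := M_gt0.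
pose L := (n * 5 ^ m.-1)%N.
have ML : M%:Z = 5 * L%:Z by rewrite -PoszM /L mulnCA -expnS prednK.
(* The candidates: the five solutions mod [M] of 5y = 5 ^ (c + 1) * f i, for each [i]. *)
pose E i (l : nat) : int := (((5 ^ c)%:Z * (f i)%:Z + l%:Z * L%:Z) %% M)%Z.
pose es := undup [seq E i l | i <- enum 'I_k, l <- iota 0 5].
pose G := [seq theta R M ((5 ^ c)%:Z * (f i)%:Z %% M)%Z | i <- enum 'I_k].
have modK (z w : int) : ((z %% M)%Z == (w %% M)%Z) = (M %| z - w)%Z by rewrite eqz_mod_dvd.
(* At most 5k nodes are used, while a form of degree 6k - 1 can take 6k prescribed values. *)
have [h H hv] : exists2 h, tform (3 * k).-1.*2.+1 h &
    {in [seq theta R M e | e <- es], forall x, h x = (x \in G)%:R}.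
  apply: tform_interpolation.
  - rewrite size_map (leq_trans (size_undup _))// size_allpairs size_iota.
    by rewrite -cardE card_ord; lia.
  - by rewrite map_inj_uniq ?undup_uniq//; exact: theta_inj.
  - move=> x y /mapP[e + ->] /mapP[e' + ->]; rewrite !mem_undup.
    move=> /allpairsP[[i l] [_ _ ->]] /allpairsP[[i' l'] [_ _ ->]].
    rewrite [(i, l).1]/= [(i, l).2]/= [(i', l').1]/= [(i', l').2]/=.
    (* If two candidates agree mod pi, [M] divides twice their difference, and by [na] also 5 times
       it, hence the difference itself. *)
    apply: contraNneq; rewrite -thetaB => /(sin_theta_eq0 M0) dv2.
    apply/eqP; congr theta; apply/eqP; rewrite eq_sym /E modK; move: dv2; rewrite /E.
    set a' := _ * _ + _; set a := _ * _ + _ => dv2.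
    have dv : (M %| 2 * (a' - a))%Z.
      have -> : 2 * (a' - a) = 2 * ((a' %% M)%Z - (a %% M)%Z)
          + 2 * ((a' %/ M)%Z - (a %/ M)%Z) * M%:Z.
        by rewrite {1}(divz_eq a' M) {1}(divz_eq a M); ring.
      by rewrite rpredD// dvdz_mull.
    have E5 : (5 ^ c.+1)%:Z * ((f i')%:Z - (f i)%:Z) = 5 * (a' - a) + (l%:Z - l'%:Z) * M%:Z.
      by rewrite /a /a' ML expnS !PoszM; ring.
    have : (M %| (5 ^ c.+1)%:Z * ((f i')%:Z - (f i)%:Z))%Z.
      apply: na; rewrite E5 mulrDr mulrCA rpredD//; first by rewrite dvdz_mull.
      by rewrite !dvdz_mull.
    rewrite E5 => dv5'.
    have dv5 : (M %| 5 * (a' - a))%Z by move: dv5'; rewrite rpredDr// dvdz_mull.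
    have -> : a' - a = 5 * (a' - a) - 2 * (2 * (a' - a)) by ring.
    by rewrite rpredB// dvdz_mull.
have hj (j : 'I_M) : psi (tA m n j) = B ->
   h ((5 ^ c)%:R * tA m n j) = `[< exists i, (M %| (5 ^ c)%:Z * (j%:Z - (f i)%:Z))%Z >]%:R.
  move=> /psiE[i dv].
  have -> : (5 ^ c)%:R * tA m n j = theta R M ((5 ^ c)%:Z * j).
    have := expn_tA_theta c j 0.
    by rewrite subr0 (_ : theta R M 0 = 0) ?subr0// /theta mulr0 mul0r.
  rewrite (theta_modz _ M0 H) hv; last first.
    apply/map_f; rewrite mem_undup; apply/allpairsP.
    case/dvdzP: dv => q dvE.
    (* A contact point of [psi] differs from some 5 ^ c * f i by a multiple [q * L], so it is the
       candidate of index [q] mod 5. *)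
    have qE : (5 ^ c)%:Z * (j%:Z - (f i)%:Z) = q * L%:Z.
      apply: (@mulfI _ (5 : int)) => //; move: dvE; rewrite ML expnS PoszM => dvE.
      by rewrite mulrA dvE; ring.
    exists (i, `|(q %% 5)%Z|%N); split; first by rewrite mem_enum.
      rewrite mem_iota add0n [_.2]/=.
      by have := ltz_pmod q (isT : 0 < 5%:Z); have := modz_ge0 q (isT : 5%:Z != 0); lia.
    rewrite [(_, _).1]/= [(_, _).2]/=; apply/eqP; rewrite modK; apply/dvdzP; exists (q %/ 5)%Z.
    rewrite gez0_abs ?modz_ge0// ML.
    have -> : (5 ^ c)%:Z * j%:Z = (5 ^ c)%:Z * (f i)%:Z + q * L%:Z by rewrite -qE; ring.
    by rewrite {1}(divz_eq q 5); ring.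
  congr (_%:R); congr nat_of_bool; apply/mapP/asboolP => [[l _ /(theta_inj M0)/eqP]|[l dl]].
    by rewrite modK -mulrBr => dl; exists l.
  by exists l; rewrite ?mem_enum//; congr theta; apply/eqP; rewrite modK -mulrBr.
pose y (j : 'I_M) := h ((5 ^ c)%:R * tA m n j).
(* Where [psi] attains [B] the denominator is 0 and the quotient is 0 by convention; every other
   term is nonnegative and bounds the ratio needed at its own [j]. *)
pose La := 1 + \sum_(j < M) `|y j| / (B - psi (tA m n j)).
have La_ge1 : 1 <= La.
  by rewrite lerDl sumr_ge0// => j _; rewrite divr_ge0// subr_ge0.
have La_lt (j : 'I_M) : psi (tA m n j) != B -> La * psi (tA m n j) + y j < La * B + 1.
  move=> jB; have jB' : 0 < B - psi (tA m n j).
    by rewrite subr_gt0 lt_neqAle jB psiB.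
  have : `|y j| / (B - psi (tA m n j)) <= La.
    rewrite /La (bigD1 j)//= addrCA lerDl addr_ge0// sumr_ge0// => i _.
    by rewrite divr_ge0// subr_ge0.
  rewrite ler_pdivrMr// => yL; have := ler_norm (y j); lra.
exists (fun x => La * psi x + h ((5 ^ c)%:R * x)), (La * B + 1); split.
- apply: lin_lin => //.
  have [C CE] : lin k m (fun x => h ((5 ^ c)%:R * x - 0)).
    by apply: (@lin_tform _ _ _ c _ _ _ cm _ H); lia.
  by exists C => x; rewrite -CE subr0.
- by nra.
- move=> j; have [jB|/La_lt/ltW //] := eqVneq (psi (tA m n j)) B.
  by rewrite jB lerD2l hj//; case: `[< _ >]; rewrite ?ler01.
- move=> j; have [jB|jB] := eqVneq (psi (tA m n j)) B.
    rewrite jB hj//; split; first by move/addrI/eqP; rewrite pnatr_eq1 eqb1 => /asboolP.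
    by move=> /asboolP ->.
  split; first by move=> jE; have := La_lt j jB; rewrite /y jE ltxx.
  move=> [i dv]; case/eqP: jB; apply/psiE; exists i.
  by rewrite expnS PoszM -mulrA dvdz_mull.
Qed.

Lemma clustered_face c : (c < m)%N -> clustered c ->
  is_face (Pkmn k m n) (conv (fun i => pt (f i))).
Proof.
move=> cm cl; apply: exposed_face.
suff: exposed 0 /\ no_antipodes 0 by case.
have : exposed c /\ no_antipodes c.
  by split; [apply: clustered_exposed => //; exact: ltnW|exact: clustered_no_antipodes].
elim: c cm {cl} => // c IH cm [ec nc]; apply: IH; first exact: ltnW.
by split; [apply: exposed_step => //; lia|exact: no_antipodesW].
Qed.
End Faces.

(** * Counting clustered tuples *)

Section Counting.
Local Close Scope classical_set_scope.
Variables (k : nat) (k_gt0 : (0 < k)%N).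
Let i0 := Ordinal k_gt0.

(** Decidable form of [clustered] for an arbitrary modulus, so that the modulus can be divided by
    5. *)
Definition clusteredb M c (f : {ffun 'I_k -> 'I_M}) := [forall i,
  5 * (((5 ^ c)%:Z * ((f i)%:Z - (f i0)%:Z)) %% M)%Z < M%:Z].

Section Step.
Variables (L M : nat).
Hypotheses (L_gt0 : (0 < L)%N) (ML : M = (5 * L)%N).

(** This is multiplication by 5 on the circle: 5 * (2 pi j / M) = 2 pi j / L depends only on [j] mod
    [L]. *)
Definition reduce (f : {ffun 'I_k -> 'I_M}) : {ffun 'I_k -> 'I_L} :=
  [ffun i => Ordinal (ltn_pmod (f i) L_gt0)].

Lemma clusteredb_reduce c (f : {ffun 'I_k -> 'I_M}) :
  clusteredb c.+1 f = clusteredb c (reduce f).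
Proof.
apply: eq_forallb => i; rewrite !ffunE /=.
have E (j : nat) : ((j %% L)%N : int) = j%:Z - (j %/ L)%N%:Z * L%:Z.
  by rewrite {2}(divn_eq j L) PoszD PoszM; ring.
rewrite !E.
set u := (f i)%:Z - (f i0)%:Z.
have -> : (5 ^ c)%:Z * ((f i)%:Z - (f i %/ L)%N%:Z * L%:Z - ((f i0)%:Z - (f i0 %/ L)%N%:Z * L%:Z))
  = (5 ^ c)%:Z * ((f i0 %/ L)%N%:Z - (f i %/ L)%N%:Z) * L%:Z + (5 ^ c)%:Z * u.
  by rewrite /u; ring.
rewrite modzMDl expnS PoszM -mulrA.
have MLz : M%:Z = 5 * L%:Z by rewrite ML PoszM.
by rewrite MLz -mulz_modr//; lia.
Qed.

Lemma five_L_gt0 : (0 < M)%N. Proof. by rewrite ML; lia. Qed.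

(* The lift of g whose first coordinate is g i0 + e * L and whose points all lie in the arc
   of L consecutive residues starting there. *)
Definition arclift (g : {ffun 'I_k -> 'I_L}) (e : 'I_5) : {ffun 'I_k -> 'I_M} :=
  [ffun i => Ordinal (ltn_pmod (g i0 + e * L + (g i + (L - g i0)) %% L) five_L_gt0)].

Lemma arclift0E g e : arclift g e i0 = (g i0 + e * L)%N :> nat.
Proof.
rewrite ffunE /= subnKC ?(ltnW (ltn_ord _))// modnn addn0 modn_small// ML.
by have := ltn_ord (g i0); have := ltn_ord e; nia.
Qed.

Lemma reduce_arclift g e : reduce (arclift g e) = g.
Proof.
apply/ffunP => i; rewrite ffunE; apply/val_inj => /=; rewrite ffunE /=.
rewrite modn_dvdm; last by rewrite ML dvdn_mull.
rewrite modnDmr.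
have -> : (g i0 + e * L + (g i + (L - g i0)) = e.+1 * L + g i)%N.
  by have := ltn_ord (g i0); nia.
by rewrite modnMDl modn_small.
Qed.

Lemma clusteredb_arclift g e : clusteredb 0 (arclift g e).
Proof.
apply/forallP => i; rewrite arclift0E ffunE /= expn0 mul1r.
set x := (g i0 + e * L)%N; set r := ((g i + (L - g i0)) %% L)%N.
have rL : (r < L)%N by rewrite ltn_pmod.
rewrite -modz_nat modzDml PoszD [x%:Z + _]addrC addrK modz_nat modn_small ML; lia.
Qed.

Lemma arclift_inj g : injective (arclift g).
Proof.
move=> e e' /(congr1 (fun h : {ffun 'I_k -> 'I_M} => h i0 : nat)).
rewrite !arclift0E => /addnI/eqP; rewrite eqn_pmul2r// => /eqP; exact: val_inj.
Qed.

(** A lift is determined by its [k] quotients by [L], each below 5, and the five lifts [arclift g e]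
    are distinct and clustered. *)
Lemma card_unclustered_fiber g :
  (#|[set f | (reduce f == g) && ~~ clusteredb 0 f]| <= 5 ^ k - 5)%N.
Proof.
pose F := [set f | reduce f == g].
pose C := [set f : {ffun 'I_k -> 'I_M} | clusteredb 0 f].
have -> : [set f | (reduce f == g) && ~~ clusteredb 0 f] = F :\: C.
  by apply/setP => f; rewrite !inE andbC.
have FC : (5 <= #|F :&: C|)%N.
  rewrite -[X in (X <= _)%N](card_ord 5) -cardsT -(card_imset _ (@arclift_inj g)).
  apply/subset_leq_card/fintype.subsetP => _ /imsetP[e _ ->].
  by rewrite !inE reduce_arclift eqxx clusteredb_arclift.
have F5 : (#|F| <= 5 ^ k)%N.
  have d5 (j : 'I_M) : (j %/ L < 5)%N by rewrite ltn_divLR// -ML.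
  pose q (f : {ffun 'I_k -> 'I_M}) : {ffun 'I_k -> 'I_5} := [ffun i => Ordinal (d5 (f i))].
  rewrite -(card_in_imset (f := q)).
    by apply: leq_trans (max_card _) _; rewrite card_ffun !card_ord.
  move=> f f'; rewrite !inE => /eqP rf /eqP rf' /ffunP qf; apply/ffunP => i.
  apply/val_inj => /=; rewrite (divn_eq (f i) L) (divn_eq (f' i) L).
  have := qf i; rewrite !ffunE => /(congr1 val)/= ->.
  have : reduce f i = reduce f' i by rewrite rf rf'.
  by rewrite !ffunE => /(congr1 val)/= ->.
by have := cardsID C F; lia.
Qed.

Lemma card_unclustered_step (P : pred {ffun 'I_k -> 'I_L}) :
  (#|[set f | P (reduce f) && ~~ clusteredb 0 f]| <= (5 ^ k - 5) * #|[set g | P g]|)%N.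
Proof.
rewrite -sum1_card (partition_big reduce P) => [|f]; last by rewrite inE => /andP[].
rewrite -sum1_card big_distrr /= [leqRHS](eq_bigl P) => [|g]; last by rewrite inE.
apply: leq_sum => g Pg; rewrite muln1.
apply: leq_trans (card_unclustered_fiber g).
rewrite sum1dep_card; apply/subset_leq_card/fintype.subsetP => f.
by rewrite !inE => /andP[/andP[_ ->] ->].
Qed.
End Step.

(** Level 0 concerns the tuple itself, level [c.+1] its reduction at level [c]. Each factor 5 of the
    modulus thus contributes [5 ^ k - 5]. *)
Lemma card_unclustered n m : (0 < n)%N ->
  (#|[set f : {ffun 'I_k -> 'I_(n * 5 ^ m)} | [forall c : 'I_m, ~~ clusteredb c f]]|
    <= (5 ^ k - 5) ^ m * n ^ k)%N.
Proof.
move=> n0; elim: m => [|m IH].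
  apply: leq_trans (max_card _) _.
  by rewrite card_ffun !card_ord expn0 mul1n muln1.
have L0 : (0 < n * 5 ^ m)%N by rewrite muln_gt0 n0 expn_gt0.
have ML : (n * 5 ^ m.+1 = 5 * (n * 5 ^ m))%N by rewrite expnS mulnCA.
rewrite [((5 ^ k - 5) ^ m.+1)%N]expnS -mulnA.
apply: leq_trans (leq_mul (leqnn _) IH).
apply: leq_trans (card_unclustered_step L0 ML
  (fun g => [forall c : 'I_m, ~~ clusteredb c g])).
apply/subset_leq_card/fintype.subsetP => f; rewrite !inE => /forallP H.
apply/andP; split; last exact: (H ord0).
apply/forallP => c; rewrite -(clusteredb_reduce L0 ML).
by have := H (fintype.lift ord0 c).
Qed.
End Counting.

(** * Dimension *)

Section Dimension.
Variables (R : realType) (k m : nat).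
Hypothesis k_gt0 : (0 < k)%N.
Local Notation N := (6 * k * m.+1)%N.
Local Notation T := ((3 * k + 2) %/ 5)%N.

Definition blk (i : nat) := (i %/ (6 * k))%N.
Definition pos (i : nat) := (i %% (6 * k))%N.
Definition freq (i : nat) := ((pos i %/ 2).*2.+1 * 5 ^ blk i)%N.

(* In a block b > 0 the frequencies below 5 ^ b * (2 * T) are those already present in block b - 1. *)
Definition fresh (i : nat) := ~~ ((0 < blk i) && (pos i < 2 * T))%N.

Lemma PsiE (x : R) (i : 'I_N) : Psi k m x 0 i =
  if odd (pos i) then sin ((freq i)%:R * x) else cos ((freq i)%:R * x).
Proof. by rewrite mxE. Qed.

Lemma pos_lt i : (pos i < 6 * k)%N.
Proof. by rewrite ltn_pmod; lia. Qed.

Lemma blk_le (i : 'I_N) : (blk i <= m)%N.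
Proof. by rewrite -ltnS ltn_divLR; [have := ltn_ord i; lia|lia]. Qed.

Lemma blkpos (b r : nat) : (r < 6 * k)%N ->
  blk (b * (6 * k) + r) = b /\ pos (b * (6 * k) + r) = r.
Proof.
move=> rk; have k6 : (0 < 6 * k)%N by lia.
by rewrite /blk /pos divnMDl// modnMDl divn_small// modn_small// addn0.
Qed.

Lemma fresh_representative (i : 'I_N) : exists j : 'I_N,
  [/\ fresh j, freq j = freq i & odd (pos j) = odd (pos i)].
Proof.
have [v vi] := ubnP (i : nat); elim: v i vi => // v IH i vi.
have [fi|] := boolP (fresh i); first by exists i.
rewrite negbK => /andP[b0 rT].
have iE : i = (blk i * (6 * k) + pos i)%N :> nat by exact: divn_eq.
(* With l = [pos i %/ 2], 5 (2l + 1) = 2 (5l + 2) + 1 gives the same frequency one block earlier; l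
   < T guarantees 5l + 2 < 3k. *)
pose r' := ((pos i %/ 2 * 5 + 2).*2 + odd (pos i))%N.
have rk' : (r' < 6 * k)%N by rewrite /r'; case: odd; lia.
have [bE rE] := blkpos (blk i).-1 rk'.
have lt_i : ((blk i).-1 * (6 * k) + r' < i)%N.
  by rewrite {2}iE; have := leq0n (pos i); nia.
have [|j [fj jf jo]] := IH (Ordinal (ltn_trans lt_i (ltn_ord i))).
  by rewrite /=; lia.
exists j; split=> //.
  rewrite jf /= /freq bE rE -[in RHS](prednK b0) expnS mulnA; congr (_ * _)%N.
  by rewrite /r'; case: odd; lia.
by rewrite jo /= rE /r' oddD odd_double oddb.
Qed.

(** If the blocks differ, 5 times the odd factor of the later frequency is at most that of the
    earlier one, hence at most 6k - 1; the later index is then not fresh. *)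
Lemma fresh_inj (i j : 'I_N) : fresh i -> fresh j -> freq i = freq j ->
  odd (pos i) = odd (pos j) -> i = j.
Proof.
wlog ij : i j / (blk i <= blk j)%N.
  by move=> H; case: (leqP (blk i) (blk j)) => [/H //|/ltnW /H] {}H *; apply/esym/H.
move=> fi fj fE oE.
have iE : i = (blk i * (6 * k) + pos i)%N :> nat by exact: divn_eq.
have jE : j = (blk j * (6 * k) + pos j)%N :> nat by exact: divn_eq.
have ri := pos_lt i; have rj := pos_lt j.
move: ij; rewrite leq_eqVlt => /orP[/eqP bE|blt].
  have : (pos i %/ 2).*2.+1 = (pos j %/ 2).*2.+1.
    by apply/eqP; rewrite -(eqn_pmul2r (m := 5 ^ blk i)) ?expn_gt0//; apply/eqP; rewrite {2}bE.
  move=> lE; apply/val_inj; rewrite /= iE jE bE; congr (_ + _)%N.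
  by rewrite -[LHS]odd_double_half -[RHS]odd_double_half -!divn2 oE; lia.
case/negP: fj; rewrite (leq_trans _ blt)//=.
move: fE; rewrite /freq -(subnKC blt) expnD expnS.
set l := (pos i %/ 2)%N; set l' := (pos j %/ 2)%N; set e := (5 ^ (_ - _))%N => fE.
have e0 : (0 < e)%N by rewrite expn_gt0.
have p0 : (0 < 5 ^ blk i)%N by rewrite expn_gt0.
have lE : l.*2.+1 = (l'.*2.+1 * 5 * e)%N.
  by apply/eqP; rewrite -(eqn_pmul2r p0) fE; apply/eqP; ring.
have : (l'.*2.+1 * 5 <= l.*2.+1)%N by rewrite lE; nia.
by rewrite /l /l'; lia.
Qed.

Lemma card_fresh : #|[pred i : 'I_N | fresh i]| = (N - 2 * m * T)%N.
Proof.
have T2 : (2 * T <= 6 * k)%N by lia.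
have lt_N (p : 'I_m * 'I_(2 * T)) : (p.1.+1 * (6 * k) + p.2 < N)%N.
  by have := ltn_ord p.1; have := ltn_ord p.2; nia.
pose g p : 'I_N := Ordinal (lt_N p).
have gE p : blk (g p) = p.1.+1 /\ pos (g p) = p.2.
  by apply: blkpos; apply: leq_trans T2.
have g_inj : injective g.
  move=> [b r] [b' r'] gg; have [B1 P1] := gE (b, r); have [B2 P2] := gE (b', r').
  move: B1 P1; rewrite gg B2 P2 /= => -[bb] rr.
  by congr (_, _); apply/val_inj.
suff E : #|[predC [pred i : 'I_N | fresh i]]| = (2 * m * T)%N.
  by have := cardC [pred i : 'I_N | fresh i]; rewrite card_ord E => /(canRL (addnK _)).
rewrite -[RHS](_ : #|{: 'I_m * 'I_(2 * T)}| = _); last first.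
  by rewrite card_prod !card_ord mulnA (mulnC m).
rewrite -(card_codom g_inj); apply: eq_card => i; rewrite !inE negbK.
apply/andP/codomP => [[b0 r0]|[p ->]]; last first.
  by have [-> ->] := gE p; split.
have bm : ((blk i).-1 < m)%N by have := blk_le i; lia.
exists (Ordinal bm, Ordinal r0); apply/val_inj => /=.
by rewrite prednK// -divn_eq.
Qed.

(** Each coordinate equals the one at its fresh representative, so a 0/1 matrix with one row per
    fresh index spans the curve. *)
Lemma Psi_span : exists V : 'M[R]_N,
  (\rank V <= N - 2 * m * T)%N /\ forall x, (Psi k m x <= V)%MS.
Proof.
pose S := [pred i : 'I_N | fresh i].
have /boolp.choice[root rootP] := fresh_representative.
have rootS i : root i \in S by have [] := rootP i.
pose B : 'M[R]_(#|S|, N) := \matrix_(a, i) (enum_val a == root i)%:R.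
exists <<B>>%MS; split=> [|x].
  by rewrite mxrank_gen -card_fresh rank_leq_row.
rewrite genmxE; apply/submxP; exists (\row_a Psi k m x 0 (enum_val a)).
apply/rowP => i; rewrite !mxE.
rewrite (bigD1 (enum_rank_in (rootS i) (root i)))//= big1 => [|a ai]; last first.
  rewrite !mxE; case: eqP => [E|_]; last by rewrite mulr0.
  by case/eqP: ai; rewrite -[LHS](enum_valK_in (rootS i)) E.
have [_ fE oE] := rootP i.
by rewrite addr0 [in RHS]mxE PsiE [in X in _ = _ * X]mxE enum_rankK_in// eqxx mulr1 fE oE -PsiE mxE.
Qed.
End Dimension.

(** * Trigonometric sums over equally spaced points *)

Section Orthogonality.
Variable R : realType.
Implicit Types (F : int).

Lemma sum_trig_telescope (h : R) (v : nat) :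
  2 * sin (h / 2) * \sum_(j < v) cos (j%:R * h) = sin (v%:R * h - h / 2) + sin (h / 2) /\
  2 * sin (h / 2) * \sum_(j < v) sin (j%:R * h) = cos (h / 2) - cos (v%:R * h - h / 2).
Proof.
elim: v => [|v [IHc IHs]]; first by rewrite !big_ord0 mul0r sub0r sinN cosN; split; ring.
rewrite !big_ord_recr /= !mulrDr IHc IHs -[v.+1%:R]natr1.
have -> : (v%:R + 1) * h - h / 2 = v%:R * h + h / 2 by field.
by rewrite !sinB !cosB !sinD !cosD; split; ring.
Qed.

Lemma sum_trig_theta (M : nat) F : (0 < M)%N -> ~~ (M %| F)%Z ->
  \sum_(j < M) cos (theta R M (F * j)) = 0 /\ \sum_(j < M) sin (theta R M (F * j)) = 0.
Proof.
move=> M0 MF; set h := theta R M F.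
have M0' : (M%:R : R) != 0 by rewrite pnatr_eq0 -lt0n.
have thE (j : nat) : theta R M (F * j) = j%:R * h.
  by rewrite /h /theta intrM -pmulrn; field.
have h2 : h / 2 = pi * F%:~R / M%:R by rewrite /h /theta; field.
have s0 : 2 * sin (h / 2) != 0.
  by rewrite mulf_neq0 ?pnatr_eq0//; apply: contraNneq MF; rewrite h2; exact: sin_pi_frac_eq0.
have Mh : M%:R * h - h / 2 = - (h / 2) + 2 * pi * F%:~R.
  by rewrite addrC; congr (_ + _); rewrite /h /theta; field.
have [Ec Es] := sum_trig_telescope h M.
have Fc : tform 1 (cos : R -> R).
  by apply: eq_tform (tform_cos 0) => x; rewrite subr0.
have Fs : tform 1 (sin : R -> R).
  by apply: eq_tform (tform_sin 0) => x; rewrite subr0.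
rewrite Mh (tform_periodic _ _ Fc) (tform_periodic _ _ Fs) sinN cosN addNr subrr in Ec Es.
under eq_bigr do rewrite thE.
under [X in _ /\ X = _]eq_bigr do rewrite thE.
by split; apply: (mulfI s0); rewrite ?Ec ?Es mulr0.
Qed.

End Orthogonality.

(** * The polytope *)

Section Assembly.
Variables (R : realType) (k m n : nat).
Hypotheses (k_gt0 : (0 < k)%N) (n_gt0 : (0 < n)%N) (n_even : ~~ odd n).
Local Notation N := (6 * k * m.+1)%N.
Local Notation M := (n * 5 ^ m)%N.
Local Notation T := ((3 * k + 2) %/ 5)%N.
Local Notation pt := (fun j : 'I_M => Psi k m (tA m n j) : 'rV[R]_N).

(** As [n] is even, adding half of [M] to the index adds pi to the point, and all frequencies are
    odd. *)
Lemma Psi_antipode : exists s : 'I_M -> 'I_M, forall j, pt (s j) = - pt j.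
Proof.
have M0 := M_gt0 m n_gt0.
exists (fun j => Ordinal (ltn_pmod (j + n./2 * 5 ^ m) M0)) => j.
have Fc : tform 1 (cos : R -> R).
  by apply: eq_tform (tform_cos 0) => x; rewrite subr0.
have Fs : tform 1 (sin : R -> R).
  by apply: eq_tform (tform_sin 0) => x; rewrite subr0.
apply/rowP => i; rewrite [in RHS]mxE !PsiE.
set F := freq k i.
have Fodd : odd F by rewrite /F /freq oddM oddX /= odd_double orbT.
suff E (f : R -> R) : tform 1 f -> f (F%:R * tA m n ((j + n./2 * 5 ^ m) %% M)%N) = - f (F%:R * tA m n j).
  by case: odd; exact: E.
move=> Ff.
(* An odd [F] turns pi into pi plus [F./2] full turns; reducing the index mod [M] removes [F] times
   the quotient. *)
have -> : F%:R * tA m n ((j + n./2 * 5 ^ m) %% M)%N =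
   F%:R * tA m n j + pi + 2 * pi * ((F./2)%:Z - (F * ((j + n./2 * 5 ^ m) %/ M))%N%:Z)%:~R :> R.
  have M0' : (M%:R : R) != 0 by rewrite pnatr_eq0 -lt0n.
  rewrite /tA /= intrB -!pmulrn.
  have E1 : (j + n./2 * 5 ^ m)%:R = ((j + n./2 * 5 ^ m) %/ M)%:R * M%:R + ((j + n./2 * 5 ^ m) %% M)%:R :> R.
    by rewrite -natrM -natrD -divn_eq.
  have E2 : F%:R = 1 + 2 * (F./2)%:R :> R.
    by rewrite -{1}(odd_double_half F) Fodd natrD -mul2n natrM.
  have E3 : M%:R = 2 * (n./2 * 5 ^ m)%:R :> R.
    have nE : n = (2 * n./2)%N by rewrite mul2n -[LHS]odd_double_half (negPf n_even).
    by rewrite {1}nE -mulnA natrM.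
  have -> : ((j + n./2 * 5 ^ m) %% M)%:R = (j + n./2 * 5 ^ m)%:R - ((j + n./2 * 5 ^ m) %/ M)%:R * M%:R :> R.
    by rewrite E1; ring.
  set q := (_ %/ M)%N; rewrite natrD [(F * q)%:R]natrM E2.
  have E4 : (n./2 * 5 ^ m)%:R = M%:R / 2 :> R by rewrite E3; field.
  rewrite E4; move: M0'; move: (M%:R : R) => Mr Mr0; field.
  exact: Mr0.
by rewrite (tform_periodic _ _ Ff) (tformDpi _ Ff) expr1 mulN1r.
Qed.

Lemma Pkmn_opp (x : 'rV[R]_N) : Pkmn k m n x <-> Pkmn k m n (- x).
Proof.
have [s sP] := Psi_antipode.
split; first exact: conv_opp sP x.
by move/(conv_opp sP); rewrite opprK.
Qed.


Lemma tA_cos_eq1 (i j : 'I_M) : cos (tA m n i - tA m n j : R) = 1 -> i = j.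
Proof.
have M0 := M_gt0 m n_gt0.
rewrite !tA_theta -thetaB => /(cos_theta_eq1 M0)/dvdzP[q E].
have := ltn_ord i; have := ltn_ord j => jM iM.
have q0 : q = 0 by nia.
by apply/val_inj; move: E; rewrite q0 mul0r /=; lia.
Qed.

Lemma lin_cos_sub (a : R) : lin k m (fun x => cos (x - a)).
Proof.
have [c cE] := @lin_tform R k m 0 0 a _ (leq0n m) (ltac:(lia) : (0 < 3 * k)%N) (tform_cos 0).
by exists c => x; rewrite -cE expn0 mul1r subr0.
Qed.

(** The functional [cos (x - tA m n j)], of frequency 1 in block 0, is maximal at this point
    only. *)
Lemma Psi_vertex (j : 'I_M) : is_vertex (Pkmn k m n) (pt j).
Proof.
have [c cE] := lin_cos_sub (tA m n j).
rewrite /is_vertex -[[set _]](conv1 (fun=> pt j)).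
apply: (@is_face_conv R N M 1 pt (fun=> j) c 1) => // i; rewrite -cE; first exact: cos_le1.
split=> [/tA_cos_eq1 ->|[_ <-]]; first by exists ord0.
by rewrite subrr cos0.
Qed.

Lemma Psi_tA_inj : injective pt.
Proof.
move=> i j ij; apply: tA_cos_eq1; have [c cE] := lin_cos_sub (tA m n j).
by rewrite cE ij -cE subrr cos0.
Qed.

Lemma conv_sub_span (V : 'M[R]_N) : (forall j, (pt j <= V)%MS) ->
  forall x, Pkmn k m n x -> (x <= V)%MS.
Proof.
move=> ptV x [l [_ [_ ->]]]; apply: summx_sub => j _.
exact: scalemx_sub (ptV j).
Qed.

Lemma affdim_Pkmn_le : (affdim (@Pkmn R k m n) <= N - 2 * m * T)%N.
Proof.
have [V [rV PV]] := Psi_span R m k_gt0.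
apply: (affdim_le (V := V) rV) => x y Px Py; apply: addmx_sub.
  by apply: conv_sub_span Px => j; exact: PV.
by rewrite eqmx_opp; apply: conv_sub_span Py => j; exact: PV.
Qed.

(** Products become sums at the frequencies F + F' and F - F'. The bound on [n] keeps every doubled
    frequency below [M], so neither is a multiple of [M] unless F = F'. *)
Lemma Psi_orthogonal (i i' : 'I_N) : (2 * (6 * k - 1) < n)%N ->
    fresh k i -> fresh k i' ->
  \sum_(j < M) pt j 0 i * pt j 0 i' = if i == i' then M%:R / 2 else 0.
Proof.
move=> nk fi fi'; have M0 := M_gt0 m n_gt0.
have freq_lt (l : 'I_N) : (0 < 2 * freq k l < M)%N.
  have pl := pos_lt k_gt0 l; have bl := blk_le k_gt0 l.
  rewrite muln_gt0 /freq muln_gt0 expn_gt0 /=.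
  apply: (@leq_ltn_trans (2 * (6 * k - 1) * 5 ^ m)); last by rewrite ltn_pmul2r ?expn_gt0.
  by rewrite -(mulnA 2 (6 * k - 1)%N) leq_mul2l /= leq_mul ?leq_pexp2l//; lia.
have /andP[f0 fM] := freq_lt i; have /andP[f0' fM'] := freq_lt i'.
pose F := (freq k i)%:Z; pose F' := (freq k i')%:Z.
have small_mult (q x z : int) : - z < x < z -> x = q * z -> x = 0.
  move=> xz xE; have q0 : q = 0 by nia.
  by rewrite xE q0 mul0r.
have [Cp Sp] : \sum_(j < M) cos (theta R M ((F + F') * j)) = 0 /\
    \sum_(j < M) sin (theta R M ((F + F') * j)) = 0.
  by apply: sum_trig_theta => //; apply/dvdzP => -[q] /small_mult; rewrite /F /F'; lia.
have [Cm Sm] : \sum_(j < M) cos (theta R M ((F - F') * j)) = (if F == F' then M%:R else 0) /\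
    \sum_(j < M) sin (theta R M ((F - F') * j)) = 0.
  case: eqP => [->|FF].
    rewrite subrr; under eq_bigr do rewrite mul0r /theta mulr0 mul0r cos0.
    under [X in _ /\ X = _]eq_bigr do rewrite mul0r /theta mulr0 mul0r sin0.
    by rewrite sumr_const card_ord big1.
  by apply: sum_trig_theta => //; apply/dvdzP => -[q] /small_mult; move: FF; rewrite /F /F'; lia.
pose a (j : 'I_M) : R := (freq k i)%:R * tA m n j.
pose b (j : 'I_M) : R := (freq k i')%:R * tA m n j.
have thp (j : 'I_M) : theta R M ((F + F') * j) = a j + b j.
  by rewrite /a /b tA_theta /theta intrM intrD -!pmulrn; ring.
have thm (j : 'I_M) : theta R M ((F - F') * j) = a j - b j.
  by rewrite /a /b tA_theta /theta intrM intrB -!pmulrn; ring.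
have Cp' : \sum_j cos (a j + b j) = 0 by rewrite -[RHS]Cp; apply: eq_bigr => j _; rewrite thp.
have Sp' : \sum_j sin (a j + b j) = 0 by rewrite -[RHS]Sp; apply: eq_bigr => j _; rewrite thp.
have Cm' : \sum_j cos (a j - b j) = (if F == F' then M%:R else 0).
  by rewrite -[RHS]Cm; apply: eq_bigr => j _; rewrite thm.
have Sm' : \sum_j sin (a j - b j) = 0 by rewrite -[RHS]Sm; apply: eq_bigr => j _; rewrite thm.
have sum_half (g h : 'I_M -> R) c d : \sum_j g j = c -> \sum_j h j = d ->
    \sum_j (g j + h j) / 2 = (c + d) / 2.
  by move=> <- <-; rewrite -mulr_suml big_split.
have sum_halfB (g h : 'I_M -> R) c d : \sum_j g j = c -> \sum_j h j = d ->
    \sum_j (g j - h j) / 2 = (c - d) / 2.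
  by move=> <- <-; rewrite -mulr_suml sumrB.
have iE : (i == i') = (F == F') && (odd (pos k i) == odd (pos k i')).
  apply/eqP/andP => [ii'|[/eqP[fE] /eqP oE]]; first by rewrite /F /F' ii' !eqxx.
  exact: fresh_inj fi fi' fE oE.
under eq_bigr do rewrite !PsiE -/(a _) -/(b _).
rewrite iE; case: (odd (pos k i)); case: (odd (pos k i')) => /=; rewrite ?andbT ?andbF.
- transitivity (\sum_j (cos (a j - b j) - cos (a j + b j)) / 2).
    by apply: eq_bigr => j _; rewrite cosB cosD; field.
  by rewrite (sum_halfB _ _ _ _ Cm' Cp') subr0; case: ifP; rewrite ?mul0r.
- transitivity (\sum_j (sin (a j + b j) + sin (a j - b j)) / 2).
    by apply: eq_bigr => j _; rewrite sinB sinD; field.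
  by rewrite (sum_half _ _ _ _ Sp' Sm') addr0 mul0r.
- transitivity (\sum_j (sin (a j + b j) - sin (a j - b j)) / 2).
    by apply: eq_bigr => j _; rewrite sinB sinD; field.
  by rewrite (sum_halfB _ _ _ _ Sp' Sm') subr0 mul0r.
- transitivity (\sum_j (cos (a j - b j) + cos (a j + b j)) / 2).
    by apply: eq_bigr => j _; rewrite cosB cosD; field.
  by rewrite (sum_half _ _ _ _ Cm' Cp') addr0; case: ifP; rewrite ?mul0r.
Qed.

Lemma affdim_Pkmn_ge : (2 * (6 * k - 1) < n)%N ->
  (N - 2 * m * T <= affdim (@Pkmn R k m n))%N.
Proof.
move=> nk; apply: affdim_ge => [|V VP]; first exact: leq_subr.
have [s sP] := Psi_antipode.
have ptP j : Pkmn k m n (pt j) by exact: conv_point.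
pose A : 'M[R]_(M, N) := \matrix_(j, i) pt j 0 i.
have AV : (A <= V)%MS.
  apply/row_subP => j; have -> : row j A = pt j by apply/rowP => i; rewrite !mxE.
  (* Central symmetry makes each point half of a difference, so [V] contains the points
     themselves. *)
  have -> : pt j = 2^-1 *: (pt j - pt (s j)).
    rewrite sP opprK scalerDr -scalerDl (_ : 2^-1 + 2^-1 = 1) ?scale1r//.
    by field.
  by apply/scalemx_sub/VP.
rewrite -(card_fresh m k_gt0); set S := [pred i : 'I_N | fresh k i].
have freshS (c : 'I_#|S|) : fresh k (enum_val c) by exact: (enum_valP c).
pose A2 := A *m (\matrix_(i < N, c < #|S|) (i == enum_val c)%:R).
have A2E j c : A2 j c = pt j 0 (enum_val c).
  rewrite mxE (bigD1 (enum_val c))//= big1 => [|i ic]; last by rewrite !mxE (negPf ic) mulr0.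
  by rewrite [A _ _]mxE [X in _ * X]mxE eqxx mulr1 addr0.
(* An invertible Gram matrix makes the fresh columns independent, which bounds the rank of [V] from
   below. *)
have Gram : A2^T *m A2 = (M%:R / 2)%:M.
  apply/matrixP => c d; rewrite !mxE.
  under eq_bigr do rewrite mxE !A2E.
  rewrite (Psi_orthogonal nk (freshS c) (freshS d)).
  by rewrite (inj_eq enum_val_inj); case: eqP; rewrite ?mulr1n ?mulr0n.
have M2 : (M%:R / 2 : R) != 0.
  by rewrite mulf_neq0 ?invr_eq0 ?pnatr_eq0// -lt0n; exact: M_gt0.
have := mxrankM_maxr A2^T A2; rewrite Gram -scalemx1 mxrank_scale_nz// mxrank1 => SA.
apply: leq_trans SA _; apply: leq_trans (mxrankM_maxl _ _) _.
exact: mxrankS.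
Qed.

Lemma clusteredb_face (f : {ffun 'I_k -> 'I_M}) (c : 'I_m) :
  clusteredb k_gt0 c f ->
  is_face (Pkmn k m n) (conv (fun i : 'I_k => pt (f i))).
Proof.
by move=> /forallP cl; apply: (@clustered_face R k m n k_gt0 n_gt0 f c (ltn_ord c)).
Qed.

Lemma card_nonface_le (B : pred {ffun 'I_k -> 'I_M}) :
    (forall f, B f -> ~ is_face (Pkmn k m n) (conv (fun i : 'I_k => pt (f i)))) ->
  #|B|%:R / (M ^ k)%:R <= (1 - ((5 ^ (k - 1))%:R)^-1) ^+ m :> R.
Proof.
move=> BP.
have cardB : (#|B| <= (5 ^ k - 5) ^ m * n ^ k)%N.
  apply: leq_trans (card_unclustered k_gt0 m n_gt0).
  apply/subset_leq_card/fintype.subsetP => f fB; rewrite inE; apply/forallP => c.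
  by apply/negP => /clusteredb_face; apply: BP.
have M0 : (0 : R) < (M ^ k)%:R by rewrite ltr0n expn_gt0 M_gt0.
rewrite ler_pdivrMr//; apply: (le_trans (y := ((5 ^ k - 5) ^ m * n ^ k)%:R)).
  by rewrite ler_nat.
have five : (5 ^ k = 5 * 5 ^ (k - 1))%N by rewrite -expnS subn1 prednK.
have p0 : (0 < 5 ^ (k - 1))%N by rewrite expn_gt0.
have -> : (M ^ k)%:R = (n ^ k)%:R * (5 ^ k)%:R ^+ m :> R.
  by rewrite expnMn natrM -natrX -!expnM [(m * k)%N]mulnC.
rewrite natrM (natrX _ (5 ^ k - 5)%N) mulrCA [leLHS]mulrC ler_wpM2l ?ler0n//.
rewrite -exprMn le_eqVlt; apply/orP; left; apply/eqP; congr (_ ^+ m).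
rewrite natrB; last by rewrite five leq_pmulr.
rewrite five natrM mulrBl mul1r mulrCA mulVf ?mulr1// pnatr_eq0 -lt0n//.
Qed.
End Assembly.

Theorem theorem1p3 (R : realType) (k m n : nat)
  (hk : (1 <= k)%N) (hn : (0 < n)%N) (hne : ~~ odd n) :
  let N := (6 * k * m.+1)%N in
  let M := (n * 5 ^ m)%N in
  let P : set 'rV[R]_N := Pkmn k m n in
  let pt := fun j : 'I_M => Psi k m (tA m n j) in
  let bound := (6 * k * m.+1 - 2 * m * ((3 * k + 2) %/ 5))%N in
  (* (1) *)
  ((forall x, P x <-> P (- x)) /\
   injective pt /\
   (forall v, is_vertex P v <-> exists j, v = pt j) /\
   (affdim P <= bound)%N /\
   ((2 * (6 * k - 1) < n)%N -> affdim P = bound)) /\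
  (* (2) *)
  (#|[set f : {ffun 'I_k -> 'I_M} |
        ~~ `[< is_face P (conv (fun i : 'I_k => pt (f i))) >] ]|%:R
     / (M ^ k)%:R
   <= (1 - ((5 ^ (k - 1))%:R)^-1) ^+ m :> R).
Proof.
move=> N M P pt bound; split; last first.
  apply: card_nonface_le => // f; rewrite inE /= => /negP nf face; apply: nf.
  exact/asboolP.
split; first exact: Pkmn_opp.
split; first exact: Psi_tA_inj.
split=> [v|].
  split; first exact: vertex_conv.
  by move=> [j ->]; exact: Psi_vertex.
split=> [|nk]; first exact: affdim_Pkmn_le.
by apply/eqP; rewrite eqn_leq affdim_Pkmn_le//= affdim_Pkmn_ge.
Qed.
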